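(* $$\sum_{k=0}^\infty\frac{\binom{2k}{k}}{(2k+1)16^k}\sum_{j=0}^k\frac{1}{(2j+1)^3}=\frac{5}{18}\pi\zeta_3.$$
   Context: $\zeta_3:=\sum_{i=1}^\infty \frac{1}{i^3}$. *)

(* Defs.v *)
From Stdlib Require Import Reals.
From Coquelicot Require Import Coquelicot.
Open Scope R_scope.

(* Index shifted by one: the sum runs over the integers [S i >= 1]. *)
Definition zeta3 : R := Series (fun i : nat => 1 / INR (S i) ^ 3).

(* Main.v *)
Require Import Defs.
From Stdlib Require Import Reals.
From Coquelicot Require Import Coquelicot.
From Stdlib Require Import Lra Lia.
Open Scope R_scope.

(** Write [J = j + 1/2], [K = k + 1/2], and let [a k] be the Taylor
    coefficients of [2 * asin (t / 2)], so that the sum of the [a k] is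
    [2 * asin (1/2) = PI / 3] ([asin_coeff_sum]).  The series to be evaluated is
    one eighth of [T], the sum over [k] of [a k] times the sum of [1 / J^3] over
    [j <= k].

    The idea is to recognise [T] as the cubic Taylor coefficient of a
    hypergeometric sum which is also an infinite product.  Consider
<<
      U x = sum_k  a k / (1 + x^2 / (3 K^2))
                   * prod_{j <= k} (1 + x^3 / (J (3 J^2 + 3 x J + x^2))).
>>
    The weight in front is even in [x] and each factor is
    [1 + x^3 / (3 J^3) + O(x^4)], so [U x - U (- x) = 2/3 * x^3 * T + O(x^4)]
    ([deformed_sum_odd]).

    On the other hand, up to an elementary factor [U x] is a nonterminating case
    of the Gessel-Stanton sum of a 5F4 at argument 1/4 ([gs_term_deformed]).
    The parameters are chosen so that the perturbations by [x] cancel to first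
    and second order in the product over [j], which is what makes the factors
    collapse to the form above.  The Gessel-Stanton sum satisfies a first-order
    recurrence in one parameter, proved by a Wilf-Zeilberger certificate
    ([gs_wz], [gs_sum_step]), and tends to 1 along it ([gs_sum_lim]).  Thus
    [ln (U x) - ln (U (- x))] is a series of logarithms of rational functions of
    [x] ([log_partial_lim]).  Expanding these to third order, the coefficients of
    [x^3] are combinations of inverse cubes and add up to [40/9 * zeta3]
    ([cube_partial_lim]).  The coefficients of [x] need no evaluation: they
    disappear from [L x - 2 * L (x / 2)], where [L] is the odd logarithm.
    Comparing the two expansions gives
    [2/3 * (T / (PI / 3)) = 40/9 * zeta3] ([odd_cube_ratio]), which is the claim. *)

(** * The Gessel-Stanton sum and its recurrence *)
Fixpoint rprod (f : nat -> R) (n : nat) : R :=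
  match n with O => 1 | S m => rprod f m * f m end.

(** The summand below is that of the Gessel-Stanton series
<<
      5F4 (2a, 2b, 1 - 2b, 1 + 2a/3, e ; a - b + 1, a + b + 1/2, 2a/3, 1 + 2a - 2e ; 1/4)
>>
    with [A = 2a] and [s = - (b - 1/4)^2].  Only even functions of [b - 1/4]
    occur, and the application needs [b - 1/4] imaginary: this is why [s] is the
    parameter. *)
Definition gs_ratio (A e s : R) (j : nat) : R :=
  (A + INR j) * (e + INR j) * ((INR j + 1/2)^2 + 4 * s)
  / (4 * (INR j + 1) * (1 + A - 2 * e + INR j)
     * ((A / 2 + 3/4 + INR j)^2 + s)).

Definition gs_term (A e s : R) (k : nat) : R :=
  (3 * INR k + A) / A * rprod (gs_ratio A e s) k.

(** The quotient of consecutive values, at [A] and [A + 2], of the Gamma product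
    that evaluates the series. *)
Definition gs_quot (A e s : R) : R :=
  (A + 1) * (A + 2) * ((A / 2 + 3/4 - e)^2 + s)
  / ((1 + A - 2 * e) * (2 + A - 2 * e) * ((A / 2 + 3/4)^2 + s)).

(** The Wilf-Zeilberger mate of the summand, found by Gosper's algorithm: the
    cofactor of the summand is a quotient of two quadratic polynomials in [k]. *)
Definition gs_cert (A e s : R) (k : nat) : R :=
  - gs_term A e s k * INR k * (4 * INR k + 4 * A - 4 * e + 2)
  / ((3 * INR k + A) * (1 + A - 2 * e + INR k)).

Lemma Rdiv_le_of (a b c : R) : 0 < b -> a <= c * b -> a / b <= c.
Proof. intros Hb H. apply Rle_div_l; lra. Qed.

Lemma sq_plus_pos (u s : R) : 0 < u -> 0 <= s -> 0 < u^2 + s.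
Proof. intros; nra. Qed.

Lemma gs_prod_shift (A e s : R) (k : nat) :
  0 < A -> 0 < 1 + A - 2 * e -> 0 <= s ->
  rprod (gs_ratio (A + 2) e s) k =
  rprod (gs_ratio A e s) k
  * ((A + INR k) * (A + 1 + INR k) / (A * (A + 1)))
  * ((1 + A - 2 * e) * (2 + A - 2 * e)
     / ((1 + A - 2 * e + INR k) * (2 + A - 2 * e + INR k)))
  * (((A / 2 + 3/4)^2 + s) / ((A / 2 + 3/4 + INR k)^2 + s)).
Proof.
  intros HA HD Hs. induction k as [|k IH].
  - simpl rprod. simpl INR.
    assert (H := sq_plus_pos (A/2 + 3/4) s ltac:(lra) Hs).
    assert (H' := sq_plus_pos (A/2 + 3/4 + 0) s ltac:(lra) Hs).
    field; repeat split; lra.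
  - simpl rprod. rewrite IH. unfold gs_ratio. rewrite S_INR.
    assert (Hk := pos_INR k). set (y := INR k) in *. clearbody y. clear IH.
    set (P := rprod _ k). clearbody P.
    assert (H := sq_plus_pos (A/2 + 3/4) s ltac:(lra) Hs).
    assert (H1 := sq_plus_pos (A/2 + 3/4 + y) s ltac:(lra) Hs).
    replace ((A + 2) / 2 + 3 / 4 + y) with (A / 2 + 3 / 4 + (y + 1)) by field.
    assert (H2 := sq_plus_pos (A/2 + 3/4 + (y + 1)) s ltac:(lra) Hs).
    field; repeat split; try lra; nra.
Qed.

(** Divided by [gs_term A e s k], this is an identity of rational functions. *)
Lemma gs_wz (A e s : R) (k : nat) :
  0 < A -> 0 < 1 + A - 2 * e -> 0 <= s ->
  gs_term A e s k - gs_quot A e s * gs_term (A + 2) e s k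
  = gs_cert A e s (S k) - gs_cert A e s k.
Proof.
  intros HA HD Hs. unfold gs_cert, gs_quot, gs_term.
  rewrite gs_prod_shift by assumption.
  simpl rprod. unfold gs_ratio. rewrite S_INR.
  assert (Hk := pos_INR k). set (y := INR k) in *. clearbody y.
  set (P := rprod _ k). clearbody P.
  assert (H := sq_plus_pos (A/2 + 3/4) s ltac:(lra) Hs).
  assert (H1 := sq_plus_pos (A/2 + 3/4 + y) s ltac:(lra) Hs).
  field; repeat split; try lra; nra.
Qed.

Lemma rprod_pos (f : nat -> R) : (forall j, 0 < f j) -> forall n, 0 < rprod f n.
Proof.
  intros Hf n. induction n as [|n IH]; simpl; [lra|].
  apply Rmult_lt_0_compat; auto.
Qed.

(** A range stable under [A -> A + 2], containing the parameters used later for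
    deformations of size at most 1/8, and on which the terms decrease
    geometrically with a common ratio. *)
Definition gs_range (A e s : R) : Prop :=
  4/3 <= A /\ 0 < e <= 13/24 /\ 0 <= s <= 1/4.

Lemma gs_ratio_pos (A e s : R) (j : nat) :
  gs_range A e s -> 0 < gs_ratio A e s j.
Proof.
  intro HR. pose proof HR as [HA [He Hs]].
  unfold gs_ratio. assert (Hk := pos_INR j).
  assert (H1 := sq_plus_pos (A/2 + 3/4 + INR j) s ltac:(lra) ltac:(lra)).
  assert (H2 := sq_plus_pos (INR j + 1/2) (4 * s) ltac:(lra) ltac:(lra)).
  apply Rdiv_lt_0_compat; repeat apply Rmult_lt_0_compat; lra.
Qed.

Lemma gs_term_pos (A e s : R) (k : nat) :
  gs_range A e s -> 0 < gs_term A e s k.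
Proof.
  intro HR. pose proof HR as [HA [He Hs]].
  unfold gs_term. assert (Hk := pos_INR k).
  apply Rmult_lt_0_compat.
  - apply Rdiv_lt_0_compat; lra.
  - apply rprod_pos. intro j. apply gs_ratio_pos, HR.
Qed.

(** The ratio of consecutive terms tends to 1/4.  It is one quarter of a product
    of four quotients, bounded by 12/11, 1, 1 and 13/4. *)
Lemma gs_term_succ_le (A e s : R) (k : nat) :
  gs_range A e s -> gs_term A e s (S k) <= 9/10 * gs_term A e s k.
Proof.
  intro HR. pose proof HR as [HA [He Hs]].
  assert (Hk := pos_INR k).
  assert (E : gs_term A e s (S k) =
    gs_term A e s k * (((A + INR k) / (1 + A - 2 * e + INR k))
    * ((e + INR k) / (INR k + 1))
    * (((INR k + 1/2)^2 + 4 * s) / ((A / 2 + 3/4 + INR k)^2 + s))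
    * ((3 * INR k + 3 + A) / (3 * INR k + A)) / 4)).
  { unfold gs_term. simpl rprod. unfold gs_ratio. rewrite S_INR.
    set (P := rprod _ k). set (y := INR k) in *. clearbody P y.
    assert (H1 := sq_plus_pos (A/2 + 3/4 + y) s ltac:(lra) ltac:(lra)).
    field; repeat split; try lra; nra. }
  rewrite E. rewrite Rmult_comm. apply Rmult_le_compat_r.
  - apply Rlt_le, gs_term_pos, HR.
  - set (y := INR k) in *. clearbody y.
    assert (H1 := sq_plus_pos (A/2 + 3/4 + y) s ltac:(lra) ltac:(lra)).
    assert (H2 := sq_plus_pos (y + 1/2) (4 * s) ltac:(lra) ltac:(lra)).
    set (u1 := (A + y) / _). set (u2 := (e + y) / _).
    set (u3 := ((y + 1/2)^2 + _) / _). set (u4 := (3 * y + 3 + A) / _).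
    assert (0 <= u1 <= 12/11).
    { split; [apply Rlt_le, Rdiv_lt_0_compat; lra|]. apply Rdiv_le_of; lra. }
    assert (0 <= u2 <= 1).
    { split; [apply Rlt_le, Rdiv_lt_0_compat; lra|]. apply Rdiv_le_of; lra. }
    assert (0 <= u3 <= 1).
    { split; [apply Rlt_le, Rdiv_lt_0_compat; lra|]. apply Rdiv_le_of; [lra|].
      (* 17/12 is the value of A / 2 + 3/4 at A = 4/3. *)
      assert ((y + 17/12)^2 <= (A/2 + 3/4 + y)^2) by (apply pow_incr; lra). nra. }
    assert (0 <= u4 <= 13/4).
    { split; [apply Rlt_le, Rdiv_lt_0_compat; lra|]. apply Rdiv_le_of; lra. }
    assert (0 <= u1 * u2 <= 12/11 * 1) by (split; [apply Rmult_le_pos|apply Rmult_le_compat]; lra).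
    assert (0 <= u1 * u2 * u3 <= 12/11 * 1 * 1) by (split; [apply Rmult_le_pos|apply Rmult_le_compat]; lra).
    assert (0 <= u1 * u2 * u3 * u4 <= 12/11 * 1 * 1 * (13/4)) by (split; [apply Rmult_le_pos|apply Rmult_le_compat]; lra).
    lra.
Qed.

Lemma gs_term_0 (A e s : R) :
  gs_range A e s -> gs_term A e s 0 = 1.
Proof.
  intro HR. pose proof HR as [HA [He Hs]].
  unfold gs_term. simpl. field. lra.
Qed.

Lemma gs_term_1_le (A e s : R) :
  gs_range A e s -> gs_term A e s 1 <= 1 / A.
Proof.
  intro HR. pose proof HR as [HA [He Hs]].
  unfold gs_term. change (rprod (gs_ratio A e s) 1) with (1 * gs_ratio A e s 0).
  unfold gs_ratio. change (INR 1) with 1. change (INR 0) with 0.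
  assert (H1 := sq_plus_pos (A/2 + 3/4 + 0) s ltac:(lra) ltac:(lra)).
  set (u3 := (A / 2 + 3/4 + 0)^2 + s) in *.
  assert (Hu : (A + 3) * (3/16) <= u3) by (unfold u3; nra).
  apply -> Rle_div_r; [|lra].
  replace ((3 * 1 + A) / A * (1 * ((A + 0) * (e + 0) * ((0 + 1/2)^2 + 4 * s)
      / (4 * (0 + 1) * (1 + A - 2 * e + 0) * u3))) * A)
   with (((3 + A) * A * (e * (1/4 + 4 * s))) / (4 * (1 + A - 2 * e) * u3))
   by (field; repeat split; lra).
  apply Rdiv_le_of. { apply Rmult_lt_0_compat; lra. }
  assert (e * (1/4 + 4 * s) <= 13/24 * (5/4)) by (apply Rmult_le_compat; lra).
  assert (A * 11 / 12 <= 1 + A - 2 * e) by lra.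
  assert (0 < (3 + A) * A) by nra.
  assert ((3 + A) * A * (e * (1/4 + 4 * s)) <= (3 + A) * A * (13/24 * (5/4)))
    by (apply Rmult_le_compat_l; lra).
  assert (4 * (A * 11 / 12) * ((A + 3) * (3/16)) <= 4 * (1 + A - 2 * e) * u3)
    by (apply Rmult_le_compat; nra).
  nra.
Qed.

Lemma gs_tail_le (A e s : R) (k : nat) :
  gs_range A e s -> gs_term A e s (S k) <= 1 / A * (9/10)^k.
Proof.
  intro HR. pose proof HR as [HA [He Hs]].
  induction k as [|k IH].
  - simpl pow. rewrite Rmult_1_r. apply gs_term_1_le, HR.
  - apply Rle_trans with (1 := gs_term_succ_le A e s (S k) HR). simpl pow. lra.
Qed.

Lemma ex_series_gs_tail (A e s : R) :
  gs_range A e s -> ex_series (fun k => gs_term A e s (S k)).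
Proof.
  intro HR. pose proof HR as [HA [He Hs]].
  apply (@ex_series_le R_AbsRing R_CompleteNormedModule) with (fun k => 1 / A * (9/10)^k).
  - intro k. change norm with Rabs. rewrite Rabs_pos_eq.
    + apply gs_tail_le, HR.
    + apply Rlt_le, gs_term_pos, HR.
  - apply (@ex_series_scal R_AbsRing R_NormedModule). apply ex_series_geom.
    rewrite Rabs_pos_eq; lra.
Qed.

Lemma ex_series_gs (A e s : R) :
  gs_range A e s -> ex_series (gs_term A e s).
Proof.
  intro HR. pose proof HR as [HA [He Hs]].
  apply ex_series_incr_1, ex_series_gs_tail, HR.
Qed.

(** The term of index 0 is 1 and the others are [O(1 / A)] in total: this fixes
    the constant left undetermined by the recurrence. *)
Lemma gs_sum_bounds (A e s : R) :
  gs_range A e s -> 1 <= Series (gs_term A e s) <= 1 + 10 / A.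
Proof.
  intro HR. pose proof HR as [HA [He Hs]].
  rewrite (Series_incr_1 _ (ex_series_gs A e s HR)), (gs_term_0 A e s HR).
  assert (0 <= Series (fun k => gs_term A e s (S k)) <= 10 / A); [|lra].
  split.
  - replace 0 with (Series (fun _ : nat => 0 * 0)) by (rewrite Series_scal_l; ring).
    apply Series_le; [|apply ex_series_gs_tail, HR].
    intro k. assert (H := gs_term_pos A e s (S k) HR). lra.
  - replace (10 / A) with (Series (fun k => 1 / A * (9/10)^k)).
    + apply Series_le.
      * intro k. split; [apply Rlt_le, gs_term_pos, HR|apply gs_tail_le, HR].
      * apply (@ex_series_scal R_AbsRing R_NormedModule). apply ex_series_geom.
        rewrite Rabs_pos_eq; lra.
    + rewrite Series_scal_l, Series_geom by (rewrite Rabs_pos_eq; lra). field. lra.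
Qed.

Lemma gs_cert_lim (A e s : R) :
  gs_range A e s -> is_lim_seq (gs_cert A e s) 0.
Proof.
  intro HR. pose proof HR as [HA [He Hs]].
  assert (B : forall k, Rabs (gs_cert A e s (S k)) <= 6 / A * (9/10)^k).
  { intro k. unfold gs_cert.
    assert (Ht := gs_tail_le A e s k HR). assert (Hp := gs_term_pos A e s (S k) HR).
    assert (Hk := pos_INR (S k)).
    set (y := INR (S k)) in *. set (t := gs_term A e s (S k)) in *. clearbody y t.
    replace (- t * y * (4 * y + 4 * A - 4 * e + 2) / ((3 * y + A) * (1 + A - 2 * e + y)))
      with (- (t * (y / (1 + A - 2 * e + y) * ((4 * y + 4 * A - 4 * e + 2) / (3 * y + A)))))
      by (field; lra).
    rewrite Rabs_Ropp.
    assert (H1 : 0 <= y / (1 + A - 2 * e + y) <= 1).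
    { split; [apply Rdiv_le_0_compat; lra|]. apply Rdiv_le_of; lra. }
    assert (H2 : 0 <= (4 * y + 4 * A - 4 * e + 2) / (3 * y + A) <= 6).
    { split; [apply Rdiv_le_0_compat; lra|]. apply Rdiv_le_of; lra. }
    rewrite Rabs_pos_eq.
    - apply Rle_trans with ((1 / A * (9/10)^k) * (1 * 6)).
      + apply Rmult_le_compat; try lra.
        * apply Rmult_le_pos; lra.
        * apply Rmult_le_compat; lra.
      + apply Req_le. field. lra.
    - apply Rmult_le_pos; [lra|]. apply Rmult_le_pos; lra. }
  apply is_lim_seq_incr_1, is_lim_seq_abs_0.
  apply is_lim_seq_le_le with (u := fun _ => 0) (w := fun k => 6 / A * (9/10)^k).
  - intro k. split; [apply Rabs_pos|apply B].
  - apply is_lim_seq_const.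
  - replace (Finite 0) with (Rbar_mult (6 / A) 0) by (simpl; f_equal; ring).
    apply is_lim_seq_scal_l, is_lim_seq_geom. rewrite Rabs_pos_eq; lra.
Qed.

(** The Wilf-Zeilberger identity telescopes; the certificate vanishes at [k = 0]
    and tends to 0 at infinity. *)
Lemma gs_sum_step (A e s : R) :
  gs_range A e s ->
  Series (gs_term A e s) = gs_quot A e s * Series (gs_term (A + 2) e s).
Proof.
  intro HR. pose proof HR as [HA [He Hs]].
  assert (E1 := ex_series_gs A e s HR).
  assert (E2 := ex_series_gs (A + 2) e s ltac:(repeat split; lra)).
  apply Rminus_diag_uniq.
  rewrite <- Series_scal_l, <- Series_minus.
  2: exact E1.
  2: apply (@ex_series_scal R_AbsRing R_NormedModule); exact E2.
  apply is_series_unique.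
  change (is_lim_seq (sum_n (fun k => gs_term A e s k
    - gs_quot A e s * gs_term (A + 2) e s k)) 0).
  apply is_lim_seq_ext with (fun n => gs_cert A e s (S n)).
  - intro n. induction n as [|n IH].
    + rewrite sum_O. rewrite gs_wz by lra.
      unfold gs_cert at 3. simpl INR. unfold Rdiv. ring.
    + rewrite sum_Sn, <- IH, gs_wz by lra. unfold plus; simpl. ring.
  - apply -> is_lim_seq_incr_1. apply gs_cert_lim, HR.
Qed.

Lemma gs_sum_lim (A e s : R) :
  gs_range A e s ->
  is_lim_seq (fun N => Series (gs_term (A + 2 * INR N) e s)) 1.
Proof.
  intros [HA [He Hs]].
  apply is_lim_seq_le_le with (u := fun _ => 1) (w := fun N => 1 + 10 * / (A + 2 * INR N)).
  - intro N. assert (HN := pos_INR N). apply gs_sum_bounds. repeat split; lra.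
  - apply is_lim_seq_const.
  - assert (H0 : is_lim_seq (fun N => / (A + 2 * INR N)) 0).
    { apply (is_lim_seq_inv _ p_infty); [|discriminate].
      apply is_lim_seq_le_p_loc with INR; [|apply is_lim_seq_INR].
      exists O. intros N _. assert (HN := pos_INR N). lra. }
    replace (Finite 1) with (Finite (1 + 10 * 0)) by (f_equal; ring).
    apply is_lim_seq_plus'; [apply is_lim_seq_const|].
    exact (is_lim_seq_scal_l _ 10 0 H0).
Qed.

(** * The cubic deformation of the arcsine series *)
Definition asin_coeff (k : nat) : R :=
  Binomial.C (2 * k) k / (INR (2 * k + 1) * 16 ^ k).

Lemma INR_double_succ (k : nat) : INR (2 * k + 1) = 2 * INR k + 1.
Proof. rewrite plus_INR, mult_INR. simpl. ring. Qed.

Lemma central_binom_succ (k : nat) :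
  Binomial.C (2 * S k) (S k)
  = Binomial.C (2 * k) k * (2 * (2 * INR k + 1) / (INR k + 1)).
Proof.
  unfold Binomial.C.
  replace (2 * S k - S k)%nat with (S k) by lia.
  replace (2 * k - k)%nat with k by lia.
  replace (2 * S k)%nat with (S (S (2 * k))) by lia.
  rewrite !fact_simpl, !mult_INR, !S_INR, mult_INR.
  assert (H := pos_INR k). assert (H' := INR_fact_neq_0 k).
  simpl (INR 2). field. split; lra.
Qed.

Lemma asin_coeff_succ (k : nat) :
  asin_coeff (S k)
  = asin_coeff k * ((INR k + 1/2)^2 / (4 * (INR k + 1) * (INR k + 3/2))).
Proof.
  unfold asin_coeff. rewrite central_binom_succ, !INR_double_succ, S_INR.
  assert (H := pos_INR k). assert (H' := pow_lt 16 k ltac:(lra)).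
  simpl pow. field. repeat split; lra.
Qed.

Lemma asin_coeff_0 : asin_coeff 0 = 1.
Proof. unfold asin_coeff, Binomial.C. simpl. field. Qed.

Lemma asin_coeff_pos (k : nat) : 0 < asin_coeff k.
Proof.
  induction k as [|k IH]; [rewrite asin_coeff_0; lra|].
  rewrite asin_coeff_succ. assert (H := pos_INR k).
  apply Rmult_lt_0_compat; [exact IH|].
  apply Rdiv_lt_0_compat; [apply pow_lt; lra|].
  apply Rmult_lt_0_compat; lra.
Qed.

(** This equals [(J + x) (3 J^2 + x^2) / (J (3 J^2 + 3 x J + x^2))] with
    [J = j + 1/2]: numerator and denominator, divided by 3, are cubics in [J] that
    differ only in the constant coefficient [x^3 / 3]. *)
Definition cubic_factor (x : R) (j : nat) : R :=
  1 + x^3 / ((INR j + 1/2)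
             * (3 * (INR j + 1/2)^2 + 3 * x * (INR j + 1/2) + x^2)).

Definition deformed_term (x : R) (k : nat) : R :=
  asin_coeff k / (1 + x^2 / (3 * (INR k + 1/2)^2)) * rprod (cubic_factor x) (S k).

Lemma cubic_denom_ge (x u : R) :
  Rabs x <= 1/8 -> 1/2 <= u -> 2 * u^2 <= 3 * u^2 + 3 * x * u + x^2.
Proof. intros Hx Hu. apply Rabs_le_between in Hx. nra. Qed.

Lemma gs_term_succ (A e s : R) (k : nat) :
  0 < A ->
  gs_term A e s (S k)
  = gs_term A e s k * (gs_ratio A e s k * (3 * INR k + 3 + A) / (3 * INR k + A)).
Proof.
  intro HA. unfold gs_term. simpl rprod. rewrite S_INR.
  assert (Hk := pos_INR k). field. split; lra.
Qed.

(** With these parameters [1 + A - 2 * e = e + 1], so that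
    [(e)_k / (e + 1)_k = e / (e + k)] cancels the factor [(3 k + A) / A], because
    [A = 3 * e].  What remains is the product of the cubic factors; the elementary
    factor and the weight come from the shift of the index by one between
    [j + 1/2] and [j + 3/2]. *)
Lemma gs_term_deformed (x : R) (k : nat) :
  Rabs x <= 1/8 ->
  gs_term (3/2 + x) (1/2 + x/3) (x^2/12) k * ((1 + 2*x) / (1 + 2*x + (2*x)^2/3))
  = deformed_term x k.
Proof.
  intro Hx. assert (Hx' := proj1 (Rabs_le_between _ _) Hx).
  assert (D0 : 0 < 1 + 2*x + (2*x)^2/3) by nra.
  induction k as [|k IH].
  - unfold deformed_term. rewrite asin_coeff_0, gs_term_0 by (repeat split; nra).
    change (rprod (cubic_factor x) 1) with (1 * cubic_factor x 0).
    unfold cubic_factor. change (INR 0) with 0.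
    assert (H := cubic_denom_ge x (0 + 1/2) Hx ltac:(lra)).
    assert (0 < 3 * (0 + 1/2)^2 + x^2) by nra.
    field. repeat split; nra.
  - rewrite gs_term_succ by lra.
    unfold deformed_term in *.
    change (rprod (cubic_factor x) (S (S k)))
      with (rprod (cubic_factor x) (S k) * cubic_factor x (S k)).
    rewrite asin_coeff_succ. set (Q := rprod _ (S k)) in *.
    match goal with |- ?t * ?r * ?f = _ => transitivity ((t * f) * r) end; [ring|].
    rewrite IH. clearbody Q. clear IH. unfold cubic_factor, gs_ratio.
    rewrite S_INR. assert (Hk := pos_INR k). set (y := INR k) in *.
    set (c := asin_coeff k). clearbody y c.
    assert (H1 := cubic_denom_ge x (y + 1 + 1/2) Hx ltac:(lra)).
    assert (0 < 3 * (y + 1/2)^2 + x^2) by nra.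
    assert (0 < 3 * (y + 1 + 1/2)^2 + x^2) by nra.
    replace (1 + (3/2 + x) - 2 * (1/2 + x/3) + y) with (3/2 + x/3 + y) by field.
    replace (((3/2 + x)/2 + 3/4 + y)^2 + x^2/12)
      with ((3 * (y + 1 + 1/2)^2 + 3 * x * (y + 1 + 1/2) + x^2) / 3) by field.
    replace ((y + 1/2)^2 + 4 * (x^2/12)) with ((3 * (y + 1/2)^2 + x^2) / 3) by field.
    replace (1 + x^2 / (3 * (y + 1/2)^2))
      with ((3 * (y + 1/2)^2 + x^2) / (3 * (y + 1/2)^2)) by (field; lra).
    replace (1 + x^2 / (3 * (y + 1 + 1/2)^2))
      with ((3 * (y + 1 + 1/2)^2 + x^2) / (3 * (y + 1 + 1/2)^2)) by (field; lra).
    field. repeat split; nra.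
Qed.

Definition odd_sq_sum (k : nat) : R := sum_f_R0 (fun j => 1 / (INR j + 1/2)^2) k.
Definition odd_cube_sum (k : nat) : R := sum_f_R0 (fun j => 1 / (INR j + 1/2)^3) k.

(** Compared with the telescoping sum of [1 / ((j + 1) (j + 2))]. *)
Lemma odd_sq_sum_le (k : nat) : 0 <= odd_sq_sum k <= 6.
Proof.
  split.
  - apply cond_pos_sum. intro j. assert (Hj := pos_INR j).
    apply Rdiv_le_0_compat; [lra|]. apply pow_lt. lra.
  - apply Rle_trans with (6 - 1 / (INR k + 1)).
    + unfold odd_sq_sum. induction k as [|k IH].
      * simpl. lra.
      * rewrite tech5, S_INR.
        assert (Hk := pos_INR k). set (y := INR k) in *. clearbody y.
        apply Rle_trans with (6 - 1 / (y + 1) + 1 / (y + 1 + 1/2)^2); [lra|].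
        assert (1 / (y + 1 + 1/2)^2 <= 1 / ((y + 1) * (y + 1 + 1))).
        { apply Rmult_le_compat_l; [lra|]. apply Rinv_le_contravar; nra. }
        assert (1 / ((y + 1) * (y + 1 + 1)) = 1 / (y + 1) - 1 / (y + 1 + 1)) by (field; lra).
        lra.
    + assert (Hk := pos_INR k). assert (0 < 1 / (INR k + 1)) by (apply Rdiv_lt_0_compat; lra).
      lra.
Qed.

Lemma odd_cube_sum_le (k : nat) : 0 <= odd_cube_sum k <= 12.
Proof.
  split.
  - apply cond_pos_sum. intro j. assert (Hj := pos_INR j).
    apply Rdiv_le_0_compat; [lra|]. apply pow_lt. lra.
  - apply Rle_trans with (2 * odd_sq_sum k); [|assert (H := odd_sq_sum_le k); lra].
    unfold odd_cube_sum, odd_sq_sum. rewrite scal_sum. apply sum_Rle.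
    intros j _. assert (Hj := pos_INR j). set (u := INR j + 1/2).
    assert (1/2 <= u) by (unfold u; lra).
    apply Rdiv_le_of; [apply pow_lt; lra|].
    replace (1 / u^2 * 2 * u^3) with (2 * u) by (field; lra). lra.
Qed.

Lemma cubic_increment_bound (x u : R) :
  Rabs x <= 1/8 -> 1/2 <= u ->
  Rabs (x^3 / (u * (3 * u^2 + 3 * x * u + x^2))) <= Rabs x^3 * (1 / u^2)
  /\ Rabs (x^3 / (u * (3 * u^2 + 3 * x * u + x^2)) - x^3 / 3 * (1 / u^3))
     <= 3 * x^4 * (1 / u^2).
Proof.
  intros Hx Hu. assert (HD := cubic_denom_ge x u Hx Hu).
  assert (Hx' := proj1 (Rabs_le_between _ _) Hx).
  set (D := 3 * u^2 + 3 * x * u + x^2) in *.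
  assert (P1 : 0 < u^2) by nra.
  assert (P2 : 0 < u * D) by nra.
  assert (P3 : 0 < u^3) by (apply pow_lt; lra).
  split.
  - unfold Rdiv at 1. rewrite Rabs_mult, <- RPow_abs.
    apply Rmult_le_compat_l; [apply pow_le, Rabs_pos|].
    rewrite Rabs_pos_eq by (apply Rlt_le, Rinv_0_lt_compat; lra).
    unfold Rdiv. rewrite Rmult_1_l. apply Rinv_le_contravar; nra.
  - replace (x^3 / (u * D) - x^3 / 3 * (1 / u^3))
      with (- (x^4 * ((3 * u + x) / (3 * (u * D) * u^2)))).
    2: { unfold D. field. repeat split; unfold D in *; nra. }
    assert (Hx4 : 0 <= x^4) by (replace (x^4) with ((x^2)^2) by ring; apply pow2_ge_0).
    rewrite Rabs_Ropp, Rabs_mult, (Rabs_pos_eq (x^4)) by exact Hx4.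
    replace (3 * x^4 * (1 / u^2)) with (x^4 * (3 / u^2)) by (field; lra).
    apply Rmult_le_compat_l; [exact Hx4|].
    rewrite Rabs_pos_eq.
    2: { apply Rdiv_le_0_compat; [lra|]. apply Rmult_lt_0_compat; lra. }
    apply Rdiv_le_of; [apply Rmult_lt_0_compat; lra|].
    replace (3 / u^2 * (3 * (u * D) * u^2)) with (9 * (u * D)) by (field; lra).
    assert (2 * u^3 <= u * D) by nra.
    assert (u^3 >= u / 4) by nra. nra.
Qed.

(** All errors are measured against the sum of [1 / J^2], which is bounded
    uniformly in [k].  The first estimate bootstraps itself: it keeps the partial
    products below 2, which is what its induction step needs; it then controls the
    quadratic terms in the second estimate. *)
Lemma cubic_prod_bound (x : R) (k : nat) :
  Rabs x <= 1/8 ->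
  Rabs (rprod (cubic_factor x) (S k) - 1) <= 2 * Rabs x^3 * odd_sq_sum k
  /\ Rabs (rprod (cubic_factor x) (S k) - 1 - x^3 / 3 * odd_cube_sum k)
     <= 4 * x^4 * odd_sq_sum k.
Proof.
  intro Hx. assert (Ha := Rabs_pos x).
  assert (H3 : 0 <= Rabs x^3 <= 1/512).
  { split; [apply pow_le; lra|]. replace (1/512) with ((1/8)^3) by field.
    apply pow_incr; lra. }
  assert (H4 : x^4 = Rabs x^3 * Rabs x).
  { replace (x^4) with ((x^2)^2) by ring. rewrite <- (pow2_abs x). ring. }
  assert (H6 : 24 * (Rabs x^3 * Rabs x^3) <= x^4).
  { rewrite H4. replace (Rabs x^3 * Rabs x^3) with (Rabs x^3 * Rabs x * Rabs x^2) by ring.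
    assert (Rabs x^2 <= 1/64) by nra. assert (0 <= Rabs x^3 * Rabs x) by nra. nra. }
  assert (step : forall j, cubic_factor x j - 1 =
      x^3 / ((INR j + 1/2) * (3 * (INR j + 1/2)^2 + 3 * x * (INR j + 1/2) + x^2)))
    by (intro; unfold cubic_factor; ring).
  induction k as [|k [IH1 IH2]].
  - change (rprod (cubic_factor x) 1) with (1 * cubic_factor x 0).
    rewrite Rmult_1_l. rewrite (step O).
    unfold odd_sq_sum, odd_cube_sum, sum_f_R0. change (INR 0) with 0.
    destruct (cubic_increment_bound x (0 + 1/2) Hx ltac:(lra)) as [B1 B2].
    assert (0 < 1 / (0 + 1/2)^2) by (apply Rdiv_lt_0_compat; [lra|apply pow_lt; lra]).
    split.
    + apply Rle_trans with (1 := B1). apply Rmult_le_compat_r; lra.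
    + apply Rle_trans with (1 := B2). apply Rmult_le_compat_r; nra.
  - assert (S6 := odd_sq_sum_le k).
    change (rprod (cubic_factor x) (S (S k)))
      with (rprod (cubic_factor x) (S k) * cubic_factor x (S k)).
    set (P := rprod _ (S k)) in *.
    change (odd_sq_sum (S k)) with (odd_sq_sum k + 1 / (INR (S k) + 1/2)^2).
    change (odd_cube_sum (S k)) with (odd_cube_sum k + 1 / (INR (S k) + 1/2)^3).
    replace (cubic_factor x (S k)) with (1 + (cubic_factor x (S k) - 1)) by ring.
    rewrite (step (S k)).
    assert (Hk := pos_INR (S k)). set (u := INR (S k) + 1/2).
    destruct (cubic_increment_bound x u Hx ltac:(unfold u; lra)) as [B1 B2].
    set (e := x^3 / (u * _)) in *.
    assert (Hv : 0 < 1 / u^2) by (apply Rdiv_lt_0_compat; [lra|apply pow_lt; unfold u; lra]).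
    set (v := 1 / u^2) in *. set (v3 := 1 / u^3) in *.
    set (s2 := odd_sq_sum k) in *. set (s3 := odd_cube_sum k) in *.
    clearbody P e v v3 s2 s3.
    assert (BP : Rabs (P - 1) <= 12 * Rabs x^3) by nra.
    split.
    + replace (P * (1 + e) - 1) with ((P - 1) + (1 + (P - 1)) * e) by ring.
      apply Rle_trans with (1 := Rabs_triang _ _). rewrite Rabs_mult.
      assert (Rabs (1 + (P - 1)) <= 2).
      { apply Rle_trans with (1 := Rabs_triang _ _). rewrite Rabs_R1. lra. }
      assert (Rabs (1 + (P - 1)) * Rabs e <= 2 * (Rabs x^3 * v))
        by (apply Rmult_le_compat; auto using Rabs_pos).
      lra.
    + replace (P * (1 + e) - 1 - x^3 / 3 * (s3 + v3))
        with ((P - 1 - x^3 / 3 * s3) + ((P - 1) * e + (e - x^3 / 3 * v3))) by ring.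
      apply Rle_trans with (1 := Rabs_triang _ _).
      assert (H := Rabs_triang ((P - 1) * e) (e - x^3 / 3 * v3)). rewrite Rabs_mult in H.
      assert (Rabs (P - 1) * Rabs e <= 12 * Rabs x^3 * (Rabs x^3 * v))
        by (apply Rmult_le_compat; auto using Rabs_pos).
      assert (12 * Rabs x^3 * (Rabs x^3 * v) <= x^4 * v) by nra.
      lra.
Qed.

(** * Odd part of the deformed sum *)
Lemma Series_le_scal (f g : nat -> R) (C : R) :
  (forall k, Rabs (f k) <= C * g k) -> ex_series g ->
  ex_series f /\ Rabs (Series f) <= C * Series g.
Proof.
  intros H Hg.
  assert (Hc : ex_series (fun k => C * g k))
    by (apply (@ex_series_scal R_AbsRing R_NormedModule); exact Hg).
  assert (Ha : ex_series (fun k => Rabs (f k))).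
  { apply (@ex_series_le R_AbsRing R_CompleteNormedModule) with (2 := Hc).
    intro k. change norm with Rabs. rewrite Rabs_Rabsolu. apply H. }
  split; [apply ex_series_Rabs, Ha|].
  apply Rle_trans with (1 := Series_Rabs _ Ha).
  rewrite <- Series_scal_l. apply Series_le; [|exact Hc].
  intro k. split; [apply Rabs_pos|apply H].
Qed.

Definition deformed_sum (x : R) : R := Series (deformed_term x).

Lemma deformed_sum_gs (x : R) :
  Rabs x <= 1/8 ->
  ex_series (deformed_term x) /\
  deformed_sum x = Series (gs_term (3/2 + x) (1/2 + x/3) (x^2/12))
                   * ((1 + 2*x) / (1 + 2*x + (2*x)^2/3)).
Proof.
  intro Hx. assert (Hx' := proj1 (Rabs_le_between _ _) Hx).
  split.
  - apply ex_series_ext with (1 := fun k => gs_term_deformed x k Hx).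
    apply ex_series_scal_r. apply ex_series_gs. repeat split; nra.
  - unfold deformed_sum.
    rewrite <- (Series_ext _ _ (fun k => gs_term_deformed x k Hx)).
    apply Series_scal_r.
Qed.

Lemma deformed_term_0 (k : nat) : deformed_term 0 k = asin_coeff k.
Proof.
  unfold deformed_term.
  replace (rprod (cubic_factor 0) (S k)) with 1.
  - assert (Hk := pos_INR k). field. lra.
  - induction (S k) as [|n IH]; simpl rprod; [reflexivity|].
    rewrite <- IH. unfold cubic_factor.
    assert (Hk := pos_INR n). field. nra.
Qed.

Lemma ex_series_asin_coeff : ex_series asin_coeff.
Proof.
  apply ex_series_ext with (1 := deformed_term_0).
  apply deformed_sum_gs. rewrite Rabs_R0. lra.
Qed.

Lemma ex_series_asin_cube : ex_series (fun k => asin_coeff k * odd_cube_sum k).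
Proof.
  apply Series_le_scal with (g := asin_coeff) (C := 12); [|apply ex_series_asin_coeff].
  intro k. assert (H := asin_coeff_pos k). assert (H' := odd_cube_sum_le k).
  rewrite Rabs_pos_eq by nra. nra.
Qed.

Lemma asin_coeff_sum_pos : 1 <= Series asin_coeff.
Proof.
  rewrite (Series_incr_1 _ ex_series_asin_coeff), asin_coeff_0.
  assert (0 <= Series (fun k => asin_coeff (S k))); [|lra].
  replace 0 with (Series (fun _ : nat => 0 * 0)) by (rewrite Series_scal_l; ring).
  apply Series_le.
  - intro k. assert (H := asin_coeff_pos (S k)). lra.
  - exact (proj1 (ex_series_incr_1 asin_coeff) ex_series_asin_coeff).
Qed.

Lemma weight_bound (x : R) (k : nat) :
  let w := / (1 + x^2 / (3 * (INR k + 1/2)^2)) in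
  0 < w <= 1 /\ Rabs (w - 1) <= 4/3 * x^2.
Proof.
  intro w. assert (Hk := pos_INR k).
  assert (Hq : 0 <= x^2 / (3 * (INR k + 1/2)^2) <= 4/3 * x^2).
  { split.
    - apply Rdiv_le_0_compat; [apply pow2_ge_0|nra].
    - apply Rdiv_le_of; [nra|]. assert (H := pow2_ge_0 x).
      assert (1 <= 4 * (INR k + 1/2)^2) by nra. nra. }
  unfold w. set (z := x^2 / _) in *. clearbody z.
  assert (E : / (1 + z) = 1 - z / (1 + z)) by (field; lra).
  assert (0 <= z / (1 + z) <= z).
  { split; [apply Rdiv_le_0_compat; lra|]. apply Rdiv_le_of; nra. }
  assert (z / (1 + z) < 1) by (apply Rlt_div_l; lra).
  rewrite E. split; [lra|].
  replace (1 - z / (1 + z) - 1) with (- (z / (1 + z))) by ring.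
  rewrite Rabs_Ropp, Rabs_pos_eq; lra.
Qed.

Lemma deformed_sum_near (x : R) :
  Rabs x <= 1/8 ->
  Rabs (deformed_sum x - Series asin_coeff) <= 4 * x^2 * Series asin_coeff.
Proof.
  intro Hx. destruct (deformed_sum_gs x Hx) as [Ex _].
  unfold deformed_sum.
  rewrite <- Series_minus by (exact Ex || exact ex_series_asin_coeff).
  apply Series_le_scal; [|apply ex_series_asin_coeff].
  intro k.
  change (deformed_term x k) with (asin_coeff k
    * / (1 + x^2 / (3 * (INR k + 1/2)^2)) * rprod (cubic_factor x) (S k)).
  destruct (weight_bound x k) as [W1 W2].
  destruct (cubic_prod_bound x k Hx) as [B _].
  assert (S6 := odd_sq_sum_le k). assert (Hc := asin_coeff_pos k).
  set (w := / (1 + x^2 / (3 * (INR k + 1/2)^2))) in *.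
  set (P := rprod _ _) in *. set (c := asin_coeff k) in *. clearbody w P c.
  replace (c * w * P - c) with (c * ((w - 1) * (1 + (P - 1)) + (P - 1))) by ring.
  rewrite Rabs_mult, (Rabs_pos_eq c) by lra.
  rewrite Rmult_comm. apply Rmult_le_compat_r; [lra|].
  apply Rle_trans with (1 := Rabs_triang _ _). rewrite Rabs_mult.
  assert (Ha := Rabs_pos x).
  assert (X2 : 0 <= Rabs x^2) by apply pow2_ge_0.
  assert (X : Rabs x^3 <= x^2 / 8).
  { rewrite <- (pow2_abs x). replace (Rabs x^3) with (Rabs x^2 * Rabs x) by ring. nra. }
  rewrite (pow2_abs x) in X2.
  assert (X3 : 0 <= Rabs x^3) by (apply pow_le; lra).
  assert (x^2 <= 1/64) by (rewrite <- (pow2_abs x); nra).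
  assert (BP : Rabs (P - 1) <= 3/2 * x^2) by nra.
  assert (Rabs (1 + (P - 1)) <= 3/2).
  { apply Rle_trans with (1 := Rabs_triang _ _). rewrite Rabs_R1. lra. }
  assert (Rabs (w - 1) * Rabs (1 + (P - 1)) <= 4/3 * x^2 * (3/2))
    by (apply Rmult_le_compat; auto using Rabs_pos).
  lra.
Qed.

(** The weight is even in [x] and differs from 1 by [O(x^2)], so it affects the
    difference only at order 5. *)
Lemma deformed_sum_odd (x : R) :
  Rabs x <= 1/8 ->
  Rabs (deformed_sum x - deformed_sum (- x)
        - 2/3 * x^3 * Series (fun k => asin_coeff k * odd_cube_sum k))
  <= 50 * x^4 * Series asin_coeff.
Proof.
  intro Hx. assert (Hx2 : Rabs (- x) <= 1/8) by (rewrite Rabs_Ropp; exact Hx).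
  destruct (deformed_sum_gs x Hx) as [Ex _].
  destruct (deformed_sum_gs (- x) Hx2) as [Ex2 _].
  unfold deformed_sum.
  rewrite <- Series_minus by assumption.
  rewrite <- Series_scal_l, <- Series_minus.
  2: apply (@ex_series_minus R_AbsRing R_NormedModule); assumption.
  2: apply (@ex_series_scal R_AbsRing R_NormedModule); exact ex_series_asin_cube.
  apply Series_le_scal; [|apply ex_series_asin_coeff].
  intro k.
  change (deformed_term x k) with (asin_coeff k
    * / (1 + x^2 / (3 * (INR k + 1/2)^2)) * rprod (cubic_factor x) (S k)).
  change (deformed_term (- x) k) with (asin_coeff k
    * / (1 + (- x)^2 / (3 * (INR k + 1/2)^2)) * rprod (cubic_factor (- x)) (S k)).
  destruct (weight_bound x k) as [W1 W2].
  destruct (cubic_prod_bound x k Hx) as [_ B1].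
  destruct (cubic_prod_bound (- x) k Hx2) as [_ B2].
  replace ((- x)^2) with (x^2) in * by ring.
  replace ((- x)^4) with (x^4) in * by ring.
  replace ((- x)^3) with (- x^3) in * by ring.
  assert (S6 := odd_sq_sum_le k). assert (S12 := odd_cube_sum_le k).
  assert (Hc := asin_coeff_pos k).
  set (w := / (1 + x^2 / (3 * (INR k + 1/2)^2))) in *.
  set (P := rprod (cubic_factor x) _) in *.
  set (Q := rprod (cubic_factor (- x)) _) in *.
  set (c := asin_coeff k) in *. set (h := odd_cube_sum k) in *.
  set (s := odd_sq_sum k) in *. clearbody w P Q c h s.
  replace (c * w * P - c * w * Q - 2/3 * x^3 * (c * h))
    with (c * (w * ((P - 1 - x^3/3 * h) - (Q - 1 - (- x^3)/3 * h))
               + (w - 1) * (2/3 * (x^3 * h)))) by field.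
  rewrite Rabs_mult, (Rabs_pos_eq c) by lra.
  rewrite (Rmult_comm c). apply Rmult_le_compat_r; [lra|].
  apply Rle_trans with (1 := Rabs_triang _ _). rewrite !Rabs_mult.
  rewrite (Rabs_pos_eq w), (Rabs_pos_eq (2/3)), (Rabs_pos_eq h), <- RPow_abs by lra.
  assert (Ha := Rabs_pos x).
  assert (X4 : 0 <= x^4) by (replace (x^4) with ((x^2)^2) by ring; apply pow2_ge_0).
  assert (X5 : x^2 * Rabs x^3 <= x^4 / 8).
  { rewrite <- (pow2_abs x).
    replace (x^4) with ((x^2)^2) by ring. rewrite <- (pow2_abs x).
    assert (0 <= Rabs x^4) by (apply pow_le; lra).
    replace (Rabs x^2 * Rabs x^3) with (Rabs x^4 * Rabs x) by ring.
    replace ((Rabs x^2)^2) with (Rabs x^4) by ring. nra. }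
  assert (X3 : 0 <= Rabs x^3) by (apply pow_le; lra).
  assert (H1 : Rabs (P - 1 - x^3/3 * h - (Q - 1 - - x^3/3 * h)) <= 48 * x^4).
  { unfold Rminus at 1. apply Rle_trans with (1 := Rabs_triang _ _).
    rewrite Rabs_Ropp. nra. }
  assert (w * Rabs (P - 1 - x^3/3 * h - (Q - 1 - - x^3/3 * h)) <= 1 * (48 * x^4))
    by (apply Rmult_le_compat; try apply Rabs_pos; lra).
  assert (Rabs (w - 1) * (2/3 * (Rabs x^3 * h)) <= 4/3 * x^2 * (2/3 * (Rabs x^3 * 12))).
  { apply Rmult_le_compat; [apply Rabs_pos|nra|exact W2|nra]. }
  nra.
Qed.

(** * Odd part of logarithms *)

(** Mean value theorem: the derivative of the difference is [- t^3 / (1 + t)]. *)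
Lemma ln_taylor3 (y : R) :
  Rabs y <= 1/2 -> Rabs (ln (1 + y) - (y - y^2/2 + y^3/3)) <= 2 * y^4.
Proof.
  intro Hy.
  destruct (MVT_gen (fun t => ln (1 + t) - (t - t^2/2 + t^3/3)) 0 y
              (fun t => - t^3 / (1 + t))) as [c [Hc E]].
  - intros t Ht. apply Rabs_le_between in Hy.
    assert (-1/2 <= t) by (destruct (Rle_dec 0 y);
      [rewrite Rmin_left in Ht | rewrite Rmin_right in Ht]; lra).
    auto_derive; [lra|]. field. lra.
  - intros t Ht. apply Rabs_le_between in Hy.
    assert (-1/2 <= t) by (destruct (Rle_dec 0 y);
      [rewrite Rmin_left in Ht | rewrite Rmin_right in Ht]; lra).
    apply continuity_pt_filterlim, (ex_derive_continuous (fun t => ln (1 + t) - (t - t^2/2 + t^3/3))).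
    auto_derive. lra.
  - simpl in E. rewrite Rplus_0_r, ln_1 in E.
    replace (ln (1 + y) - (y - y^2/2 + y^3/3)) with (- c^3 / (1 + c) * y)
      by (simpl; lra).
    assert (Hcy : Rabs c <= Rabs y).
    { unfold Rmin, Rmax in Hc. destruct (Rle_dec 0 y).
      - rewrite !Rabs_pos_eq; lra.
      - rewrite !Rabs_left1; lra. }
    assert (Hc2 : -1/2 <= c) by (apply Rabs_le_between in Hy;
       assert (H := proj1 (Rabs_le_between _ _) (Rle_trans _ _ _ Hcy (Rabs_le (y) (1/2) ltac:(lra)))); lra).
    rewrite Rabs_mult. unfold Rdiv. rewrite Rabs_mult, Rabs_Ropp, <- RPow_abs.
    rewrite (Rabs_pos_eq (/ _)) by (apply Rlt_le, Rinv_0_lt_compat; lra).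
    assert (/ (1 + c) <= 2).
    { replace 2 with (/ (1/2)) by field. apply Rinv_le_contravar; lra. }
    assert (0 < / (1 + c)) by (apply Rinv_0_lt_compat; lra).
    assert (Rabs c^3 <= Rabs y^3) by (apply pow_incr; split; [apply Rabs_pos|exact Hcy]).
    replace (2 * y^4) with (Rabs y^3 * 2 * Rabs y).
    2: { replace (y^4) with ((y^2)^2) by ring. rewrite <- (pow2_abs y). ring. }
    apply Rmult_le_compat_r; [apply Rabs_pos|].
    apply Rmult_le_compat; try lra. apply pow_le, Rabs_pos.
Qed.

(** The linear and quadratic factors of the infinite product are all of the form
    [1 + y + r * y^2], with [r = 0], [r = 1] (from [(M^3 - N^3) / (M - N)]) or
    [r = 1/3] (from [(M + N)^3 - M^3]). *)
Definition log_odd (r y : R) : R := ln (1 + y + r * y^2) - ln (1 - y + r * y^2).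

Lemma log_quadratic (r y : R) :
  0 <= r <= 1 -> Rabs y <= 1/4 ->
  Rabs (ln (1 + y + r * y^2) - (y + (r - 1/2) * y^2 + (1/3 - r) * y^3)) <= 10 * y^4.
Proof.
  intros Hr Hy. assert (Hy' := proj1 (Rabs_le_between _ _) Hy).
  set (u := y + r * y^2).
  assert (U0 : u = y * (1 + r * y)) by (unfold u; ring).
  assert (Hry : Rabs (1 + r * y) <= 5/4).
  { apply Rabs_le. split; nra. }
  assert (U1 : Rabs u <= 5/4 * Rabs y).
  { rewrite U0, Rabs_mult. assert (H := Rabs_pos y). nra. }
  assert (U4 : u^4 <= (5/4)^4 * y^4).
  { replace (u^4) with ((u^2)^2) by ring. rewrite <- (pow2_abs u).
    replace (y^4) with ((y^2)^2) by ring. rewrite <- (pow2_abs y).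
    replace ((Rabs u^2)^2) with (Rabs u^4) by ring.
    replace ((5/4)^4 * (Rabs y^2)^2) with ((5/4 * Rabs y)^4) by field.
    apply pow_incr. split; [apply Rabs_pos|exact U1]. }
  assert (T := ln_taylor3 u ltac:(lra)).
  replace (1 + y + r * y^2) with (1 + u) by (unfold u; ring).
  set (Lu := ln (1 + u)) in *. clearbody Lu.
  set (q := r^2 * (-1/2) + r + r^2 * y + r^3 * y^2 / 3).
  replace (Lu - (y + (r - 1/2) * y^2 + (1/3 - r) * y^3))
    with ((Lu - (u - u^2/2 + u^3/3)) + y^4 * q).
  2: { unfold q, u. field. }
  apply Rle_trans with (1 := Rabs_triang _ _).
  assert (Y4 : 0 <= y^4) by (replace (y^4) with ((y^2)^2) by ring; apply pow2_ge_0).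
  rewrite Rabs_mult, (Rabs_pos_eq (y^4)) by exact Y4.
  assert (Hq : Rabs q <= 5).
  { assert (R2 : 0 <= r^2 <= 1) by nra.
    assert (R3 : 0 <= r^3 <= 1) by (replace (r^3) with (r^2 * r) by ring; nra).
    assert (0 <= y^2 <= 1/16) by nra.
    assert (-1/4 <= r^2 * y <= 1/4) by nra.
    assert (0 <= r^3 * y^2 <= 1) by nra.
    apply Rabs_le. unfold q. lra. }
  nra.
Qed.

(** For [r = 1/3] the cubic coefficient vanishes. *)
Lemma log_odd_bound (r y : R) :
  0 <= r <= 1 -> Rabs y <= 1/4 ->
  Rabs (log_odd r y - (2 * y + 2 * (1/3 - r) * y^3)) <= 20 * y^4.
Proof.
  intros Hr Hy.
  assert (H1 := log_quadratic r y Hr Hy).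
  assert (H2 := log_quadratic r (- y) Hr ltac:(rewrite Rabs_Ropp; exact Hy)).
  replace ((- y)^2) with (y^2) in H2 by ring.
  replace ((- y)^4) with (y^4) in H2 by ring.
  replace (1 + - y + r * y^2) with (1 - y + r * y^2) in H2 by ring.
  unfold log_odd. set (a := ln (1 + y + _)) in *. set (b := ln (1 - y + _)) in *.
  replace (a - b - (2 * y + 2 * (1/3 - r) * y^3))
    with ((a - (y + (r - 1/2) * y^2 + (1/3 - r) * y^3))
          - (b - (- y + (r - 1/2) * y^2 + (1/3 - r) * (- y)^3))) by field.
  unfold Rminus at 1. apply Rle_trans with (1 := Rabs_triang _ _).
  rewrite Rabs_Ropp. lra.
Qed.

Lemma deformed_sum_pos (x : R) : Rabs x <= 1/8 -> 0 < deformed_sum x.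
Proof.
  intro Hx. assert (H := deformed_sum_near x Hx). assert (H1 := asin_coeff_sum_pos).
  apply Rabs_le_between in H.
  assert (x^2 <= 1/64) by (rewrite <- (pow2_abs x); assert (Ha := Rabs_pos x); nra).
  nra.
Qed.

(** Both values are within [O(x^2)] of the value [A] at 0, so replacing
    [ln t - ln A] by [(t - A) / A] costs [O(x^4)]. *)
Lemma log_deformed_sum_odd (x : R) :
  Rabs x <= 1/8 ->
  Rabs (ln (deformed_sum x) - ln (deformed_sum (- x))
        - 2/3 * x^3 * (Series (fun k => asin_coeff k * odd_cube_sum k) / Series asin_coeff))
  <= 82 * x^4.
Proof.
  intro Hx. assert (Hx2 : Rabs (- x) <= 1/8) by (rewrite Rabs_Ropp; exact Hx).
  assert (N1 := deformed_sum_near x Hx). assert (N2 := deformed_sum_near (- x) Hx2).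
  assert (O := deformed_sum_odd x Hx).
  assert (Hs := asin_coeff_sum_pos).
  assert (P1 := deformed_sum_pos x Hx). assert (P2 := deformed_sum_pos (- x) Hx2).
  replace ((- x)^2) with (x^2) in N2 by ring.
  set (T := Series (fun k => _)) in *. set (A := Series asin_coeff) in *.
  set (u := deformed_sum x) in *. set (v := deformed_sum (- x)) in *.
  clearbody T A u v.
  assert (X2 : 0 <= x^2 <= 1/64).
  { split; [apply pow2_ge_0|]. rewrite <- (pow2_abs x). assert (Ha := Rabs_pos x). nra. }
  assert (one : forall t, 0 < t -> Rabs (t - A) <= 4 * x^2 * A ->
            Rabs (ln t - ln A - (t - A) / A) <= 16 * x^4).
  { intros t Ht Hn.
    replace t with (A * (1 + (t - A) / A)) at 1 by (field; lra).
    assert (Hy : Rabs ((t - A) / A) <= 4 * x^2).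
    { unfold Rdiv. rewrite Rabs_mult, (Rabs_pos_eq (/ A)) by (apply Rlt_le, Rinv_0_lt_compat; lra).
      change (Rabs (t - A) / A <= 4 * x^2). apply Rdiv_le_of; lra. }
    set (y := (t - A) / A) in *.
    assert (Hy' := proj1 (Rabs_le_between _ _) Hy).
    rewrite ln_mult by lra.
    assert (L := ln_taylor3 y ltac:(lra)). clearbody y.
    replace (ln A + ln (1 + y) - ln A - y) with (ln (1 + y) - y) by ring.
    replace (ln (1 + y) - y) with ((ln (1 + y) - (y - y^2/2 + y^3/3)) + y^2 * (-1/2 + y/3)) by field.
    apply Rle_trans with (1 := Rabs_triang _ _). rewrite Rabs_mult.
    assert (Rabs (-1/2 + y/3) <= 3/4) by (apply Rabs_le; lra).
    assert (Y2 : y^2 <= 16 * x^4).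
    { rewrite <- (pow2_abs y). replace (16 * x^4) with ((4 * x^2)^2) by ring.
      apply pow_incr. split; [apply Rabs_pos|exact Hy]. }
    assert (0 <= y^2) by apply pow2_ge_0. rewrite (Rabs_pos_eq (y^2)) by assumption.
    replace (y^4) with (y^2 * y^2) in L by ring.
    assert (y^2 <= 1/16 * (1/16)) by nra.
    nra. }
  assert (L1 := one u P1 N1). assert (L2 := one v P2 N2).
  replace (ln u - ln v - 2/3 * x^3 * (T / A))
    with ((ln u - ln A - (u - A) / A) - (ln v - ln A - (v - A) / A)
          + (u - v - 2/3 * x^3 * T) / A) by (field; lra).
  apply Rle_trans with (1 := Rabs_triang _ _).
  assert (Rabs ((u - v - 2/3 * x^3 * T) / A) <= 50 * x^4).
  { unfold Rdiv at 1. rewrite Rabs_mult, (Rabs_pos_eq (/ A)) by (apply Rlt_le, Rinv_0_lt_compat; lra).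
    change (Rabs (u - v - 2/3 * x^3 * T) / A <= 50 * x^4). apply Rdiv_le_of; lra. }
  assert (H' := Rabs_triang (ln u - ln A - (u - A) / A) (- (ln v - ln A - (v - A) / A))).
  rewrite Rabs_Ropp in H'. unfold Rminus at 1.
  lra.
Qed.

(** * The infinite product *)
Definition log_step (x : R) (n : nat) : R :=
  log_odd 0 (x / (2 * INR n + 5/2)) + log_odd 0 (x / (2 * INR n + 7/2))
  - log_odd 0 (x / (3 * (2 * INR n + 3/2))) - log_odd 0 (x / (3 * (2 * INR n + 5/2)))
  + log_odd 1 (x / (3 * (INR n + 1))) - log_odd (1/3) (x / (INR n + 3/2)).

(** The value [A = 3/2 + x + 2 n] is that reached after [n] steps of the
    recurrence. *)
Definition gs_quot_at (x : R) (n : nat) : R :=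
  gs_quot (3/2 + x + 2 * INR n) (1/2 + x/3) (x^2/12).

Lemma quadratic_pos (r y : R) : 0 <= r -> Rabs y <= 1/4 -> 0 < 1 + y + r * y^2.
Proof. intros Hr Hy. apply Rabs_le_between in Hy. nra. Qed.

Lemma Rabs_div_le (x d c : R) : 0 < c <= d -> Rabs (x / d) <= Rabs x / c.
Proof.
  intros [Hc Hd]. unfold Rdiv. rewrite Rabs_mult, (Rabs_pos_eq (/ d)).
  - apply Rmult_le_compat_l; [apply Rabs_pos|]. apply Rinv_le_contravar; lra.
  - apply Rlt_le, Rinv_0_lt_compat; lra.
Qed.

Lemma ln_gs_quot_at (x : R) (n : nat) :
  Rabs x <= 1/8 ->
  0 < gs_quot_at x n /\
  ln (gs_quot_at x n) =
    ln ((2 * INR n + 7/2) * (INR n + 1)^2 / ((2 * INR n + 3/2) * (INR n + 3/2)^2))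
    + ln (1 + x / (2 * INR n + 5/2) + 0 * (x / (2 * INR n + 5/2))^2)
    + ln (1 + x / (2 * INR n + 7/2) + 0 * (x / (2 * INR n + 7/2))^2)
    + ln (1 + x / (3 * (INR n + 1)) + 1 * (x / (3 * (INR n + 1)))^2)
    - ln (1 + x / (3 * (2 * INR n + 3/2)) + 0 * (x / (3 * (2 * INR n + 3/2)))^2)
    - ln (1 + x / (3 * (2 * INR n + 5/2)) + 0 * (x / (3 * (2 * INR n + 5/2)))^2)
    - ln (1 + x / (INR n + 3/2) + 1/3 * (x / (INR n + 3/2))^2).
Proof.
  intro Hx. assert (Hn := pos_INR n). set (m := INR n) in *.
  assert (bnd : forall d, 1 <= d -> Rabs (x / d) <= 1/4).
  { intros d Hd. apply Rle_trans with (1 := Rabs_div_le x d 1 ltac:(lra)). lra. }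
  assert (Q1 := quadratic_pos 0 _ ltac:(lra) (bnd (2 * m + 5/2) ltac:(lra))).
  assert (Q2 := quadratic_pos 0 _ ltac:(lra) (bnd (2 * m + 7/2) ltac:(lra))).
  assert (Q3 := quadratic_pos 1 _ ltac:(lra) (bnd (3 * (m + 1)) ltac:(lra))).
  assert (Q4 := quadratic_pos 0 _ ltac:(lra) (bnd (3 * (2 * m + 3/2)) ltac:(lra))).
  assert (Q5 := quadratic_pos 0 _ ltac:(lra) (bnd (3 * (2 * m + 5/2)) ltac:(lra))).
  assert (Q6 := quadratic_pos (1/3) _ ltac:(lra) (bnd (m + 3/2) ltac:(lra))).
  set (K := (2 * m + 7/2) * (m + 1)^2 / ((2 * m + 3/2) * (m + 3/2)^2)).
  assert (HK : 0 < K).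
  { unfold K. apply Rdiv_lt_0_compat; apply Rmult_lt_0_compat; try lra; apply pow_lt; lra. }
  assert (E : gs_quot_at x n =
    K * (1 + x / (2 * m + 5/2) + 0 * (x / (2 * m + 5/2))^2)
      * (1 + x / (2 * m + 7/2) + 0 * (x / (2 * m + 7/2))^2)
      * (1 + x / (3 * (m + 1)) + 1 * (x / (3 * (m + 1)))^2)
      * / (1 + x / (3 * (2 * m + 3/2)) + 0 * (x / (3 * (2 * m + 3/2)))^2)
      * / (1 + x / (3 * (2 * m + 5/2)) + 0 * (x / (3 * (2 * m + 5/2)))^2)
      * / (1 + x / (m + 3/2) + 1/3 * (x / (m + 3/2))^2)).
  { unfold gs_quot_at, gs_quot, K. fold m.
    assert (Hx' := proj1 (Rabs_le_between _ _) Hx).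
    assert (R : 1 + x / (m + 3/2) + 1/3 * (x / (m + 3/2))^2
      = (3 * (m + 3/2)^2 + 3 * x * (m + 3/2) + x^2) / (3 * (m + 3/2)^2)) by (field; lra).
    assert (HR := cubic_denom_ge x (m + 3/2) Hx ltac:(lra)).
    rewrite R.
    replace (((3/2 + x + 2 * m) / 2 + 3/4)^2 + x^2/12)
      with ((3 * (m + 3/2)^2 + 3 * x * (m + 3/2) + x^2) / 3) by field.
    replace (((3/2 + x + 2 * m) / 2 + 3/4 - (1/2 + x/3))^2 + x^2/12)
      with ((m + 1)^2 * (1 + x / (3 * (m + 1)) + 1 * (x / (3 * (m + 1)))^2)) by (field; lra).
    replace (1 + (3/2 + x + 2 * m) - 2 * (1/2 + x/3)) with (2 * m + 3/2 + x/3) by field.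
    replace (2 + (3/2 + x + 2 * m) - 2 * (1/2 + x/3)) with (2 * m + 5/2 + x/3) by field.
    clear Q1 Q2 Q3 Q4 Q5 Q6 R HK bnd. clearbody m.
    set (q3 := 1 + x / (3 * (m + 1)) + _). clearbody q3.
    assert (0 < (m + 3/2)^2) by (apply pow_lt; lra).
    field. repeat split; try lra; nra. }
  rewrite E. clear E bnd.
  set (q1 := 1 + x / (2 * m + 5/2) + _) in *. set (q2 := 1 + x / (2 * m + 7/2) + _) in *.
  set (q3 := 1 + x / (3 * (m + 1)) + _) in *.
  set (q4 := 1 + x / (3 * (2 * m + 3/2)) + _) in *.
  set (q5 := 1 + x / (3 * (2 * m + 5/2)) + _) in *.
  set (q6 := 1 + x / (m + 3/2) + _) in *.
  clearbody K q1 q2 q3 q4 q5 q6.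
  assert (I4 := Rinv_0_lt_compat _ Q4). assert (I5 := Rinv_0_lt_compat _ Q5).
  assert (I6 := Rinv_0_lt_compat _ Q6).
  assert (K1 := Rmult_lt_0_compat _ _ HK Q1). assert (K2 := Rmult_lt_0_compat _ _ K1 Q2).
  assert (K3 := Rmult_lt_0_compat _ _ K2 Q3). assert (K4 := Rmult_lt_0_compat _ _ K3 I4).
  assert (K5 := Rmult_lt_0_compat _ _ K4 I5). assert (K6 := Rmult_lt_0_compat _ _ K5 I6).
  split; [exact K6|].
  rewrite !ln_mult, !ln_Rinv by assumption. ring.
Qed.

(** The constant [ln] in [ln_gs_quot_at] is the same for [x] and [- x]. *)
Lemma ln_gs_quot_odd (x : R) (n : nat) :
  Rabs x <= 1/8 -> ln (gs_quot_at x n) - ln (gs_quot_at (- x) n) = log_step x n.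
Proof.
  intro Hx. destruct (ln_gs_quot_at x n Hx) as [_ E1].
  destruct (ln_gs_quot_at (- x) n ltac:(rewrite Rabs_Ropp; exact Hx)) as [_ E2].
  rewrite E1, E2. unfold log_step, log_odd.
  assert (sw : forall r d, 1 + - x / d + r * (- x / d)^2 = 1 - x / d + r * (x / d)^2)
    by (intros; unfold Rdiv; ring).
  rewrite !sw. ring.
Qed.

Definition gs_sum_at (x : R) (n : nat) : R :=
  Series (gs_term (3/2 + x + 2 * INR n) (1/2 + x/3) (x^2/12)).

Lemma gs_params (x : R) (n : nat) :
  Rabs x <= 1/8 ->
  gs_range (3/2 + x + 2 * INR n) (1/2 + x/3) (x^2/12).
Proof.
  intro Hx. apply Rabs_le_between in Hx. assert (Hn := pos_INR n).
  repeat split; nra.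
Qed.

Lemma ln_gs_sum_step (x : R) (n : nat) :
  Rabs x <= 1/8 ->
  ln (gs_sum_at x n) = ln (gs_quot_at x n) + ln (gs_sum_at x (S n)).
Proof.
  intro Hx. assert (HR := gs_params x n Hx). assert (HR' := gs_params x (S n) Hx).
  destruct (ln_gs_quot_at x n Hx) as [Hq _].
  unfold gs_sum_at at 1. rewrite gs_sum_step by exact HR.
  change (gs_quot (3/2 + x + 2 * INR n) (1/2 + x/3) (x^2/12)) with (gs_quot_at x n).
  replace (3/2 + x + 2 * INR n + 2) with (3/2 + x + 2 * INR (S n)) by (rewrite S_INR; ring).
  change (Series (gs_term (3/2 + x + 2 * INR (S n)) (1/2 + x/3) (x^2/12)))
    with (gs_sum_at x (S n)).
  apply ln_mult; [exact Hq|].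
  assert (B := gs_sum_bounds _ _ _ HR').
  unfold gs_sum_at. lra.
Qed.

(** The first two terms come from the elementary factor between the
    Gessel-Stanton sum and the deformed sum. *)
Definition log_partial (x : R) (N : nat) : R :=
  log_odd 0 (2 * x) - log_odd (1/3) (2 * x) + sum_f_R0 (log_step x) N.

Lemma log_deformed_sum_partial (x : R) (N : nat) :
  Rabs x <= 1/8 ->
  ln (deformed_sum x) - ln (deformed_sum (- x))
  = log_partial x N + (ln (gs_sum_at x (S N)) - ln (gs_sum_at (- x) (S N))).
Proof.
  intro Hx. assert (Hx2 : Rabs (- x) <= 1/8) by (rewrite Rabs_Ropp; exact Hx).
  assert (head : forall y, Rabs y <= 1/8 ->
    ln (deformed_sum y) = ln (gs_sum_at y 0)
      + ln (1 + 2 * y + 0 * (2 * y)^2) - ln (1 + 2 * y + 1/3 * (2 * y)^2)).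
  { intros y Hy.
    assert (Hy2 : Rabs (2 * y) <= 1/4) by (rewrite Rabs_mult, (Rabs_pos_eq 2); lra).
    destruct (deformed_sum_gs y Hy) as [_ E]. rewrite E.
    assert (B := gs_sum_bounds _ _ _ (gs_params y 0 Hy)).
    replace (3/2 + y) with (3/2 + y + 2 * INR 0) by (simpl; ring).
    change (Series (gs_term (3/2 + y + 2 * INR 0) (1/2 + y/3) (y^2/12)))
      with (gs_sum_at y 0) in *.
    assert (Q1 := quadratic_pos 0 _ ltac:(lra) Hy2).
    assert (Q2 := quadratic_pos (1/3) _ ltac:(lra) Hy2).
    replace (1 + 2 * y) with (1 + 2 * y + 0 * (2 * y)^2) at 1 by ring.
    replace (1 + 2 * y + (2 * y)^2 / 3) with (1 + 2 * y + 1/3 * (2 * y)^2) by field.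
    unfold Rdiv at 1. rewrite !ln_mult, ln_Rinv; try assumption; try ring; try lra.
    - apply Rinv_0_lt_compat; assumption.
    - apply Rmult_lt_0_compat; [assumption|]. apply Rinv_0_lt_compat; assumption. }
  assert (H0 : ln (deformed_sum x) - ln (deformed_sum (- x))
    = log_odd 0 (2 * x) - log_odd (1/3) (2 * x)
      + (ln (gs_sum_at x 0) - ln (gs_sum_at (- x) 0))).
  { rewrite (head x Hx), (head (- x) Hx2). unfold log_odd.
    assert (sw : forall r, 1 + 2 * - x + r * (2 * - x)^2 = 1 - 2 * x + r * (2 * x)^2)
      by (intro; ring).
    rewrite !sw. ring. }
  unfold log_partial. rewrite H0. clear H0 head.
  assert (step : forall n, ln (gs_sum_at x n) - ln (gs_sum_at (- x) n)
    = log_step x n + (ln (gs_sum_at x (S n)) - ln (gs_sum_at (- x) (S n)))).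
  { intro n. rewrite (ln_gs_sum_step x n Hx), (ln_gs_sum_step (- x) n Hx2).
    rewrite <- (ln_gs_quot_odd x n Hx). ring. }
  induction N as [|N IH].
  - rewrite (step O). simpl sum_f_R0. ring.
  - rewrite IH, (step (S N)), tech5. ring.
Qed.

Lemma log_partial_lim (x : R) :
  Rabs x <= 1/8 ->
  is_lim_seq (log_partial x) (ln (deformed_sum x) - ln (deformed_sum (- x))).
Proof.
  intro Hx.
  assert (lim : forall y, Rabs y <= 1/8 ->
    is_lim_seq (fun N => ln (gs_sum_at y (S N))) 0).
  { intros y Hy. rewrite <- ln_1.
    assert (HR := gs_params y 0 Hy). simpl INR in HR. rewrite Rmult_0_r, Rplus_0_r in HR.
    apply is_lim_seq_continuous.
    - apply derivable_continuous_pt. exists (/ 1). apply derivable_pt_lim_ln. lra.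
    - apply -> (is_lim_seq_incr_1 (gs_sum_at y)).
      apply gs_sum_lim, HR. }
  replace (ln (deformed_sum x) - ln (deformed_sum (- x)))
    with (ln (deformed_sum x) - ln (deformed_sum (- x)) - (0 - 0)) by ring.
  apply is_lim_seq_ext with (fun N => ln (deformed_sum x) - ln (deformed_sum (- x))
    - (ln (gs_sum_at x (S N)) - ln (gs_sum_at (- x) (S N)))).
  - intro N. rewrite (log_deformed_sum_partial x N Hx). ring.
  - apply is_lim_seq_minus'; [apply is_lim_seq_const|].
    apply is_lim_seq_minus'; apply lim; [exact Hx|].
    rewrite Rabs_Ropp; exact Hx.
Qed.

(** * Third-order coefficients *)
Definition lin_step (n : nat) : R :=
  2 / (2 * INR n + 5/2) + 2 / (2 * INR n + 7/2)
  - 2 / (3 * (2 * INR n + 3/2)) - 2 / (3 * (2 * INR n + 5/2))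
  + 2 / (3 * (INR n + 1)) - 2 / (INR n + 3/2).

Definition cube_step (n : nat) : R :=
  2/3 * (1 / (2 * INR n + 5/2)^3 + 1 / (2 * INR n + 7/2)^3)
  - 2/81 * (1 / (2 * INR n + 3/2)^3 + 1 / (2 * INR n + 5/2)^3)
  - 4/81 * (1 / (INR n + 1)^3).

(** Six applications of [log_odd_bound] to arguments of size at most
    [|x| / (n + 1)]; the error is summable in [n]. *)
Lemma log_step_bound (x : R) (n : nat) :
  Rabs x <= 1/8 ->
  Rabs (log_step x n - (x * lin_step n + x^3 * cube_step n))
  <= 120 * x^4 * (1 / (INR n + 1)^2).
Proof.
  intro Hx. assert (Hn := pos_INR n). unfold log_step, lin_step, cube_step.
  set (m := INR n) in *. clearbody m.
  assert (X4 : 0 <= x^4) by (replace (x^4) with ((x^2)^2) by ring; apply pow2_ge_0).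
  assert (one : forall r d, 0 <= r <= 1 -> m + 1 <= d ->
    Rabs (log_odd r (x / d) - (2 * (x / d) + 2 * (1/3 - r) * (x / d)^3))
    <= 20 * x^4 * (1 / (m + 1)^2)).
  { intros r d Hr Hd.
    apply Rle_trans with (20 * (x / d)^4).
    - apply log_odd_bound; [exact Hr|].
      apply Rle_trans with (1 := Rabs_div_le x d 1 ltac:(lra)). lra.
    - replace (20 * (x / d)^4) with (20 * x^4 * (1 / d^4)) by (field; lra).
      apply Rmult_le_compat_l; [lra|].
      apply Rmult_le_compat_l; [lra|]. apply Rinv_le_contravar; [apply pow_lt; lra|].
      apply Rle_trans with (d^2); [apply pow_incr; lra|].
      apply Rle_pow; [lra|lia]. }
  assert (B1 := one 0 (2 * m + 5/2) ltac:(lra) ltac:(lra)).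
  assert (B2 := one 0 (2 * m + 7/2) ltac:(lra) ltac:(lra)).
  assert (B3 := one 0 (3 * (2 * m + 3/2)) ltac:(lra) ltac:(lra)).
  assert (B4 := one 0 (3 * (2 * m + 5/2)) ltac:(lra) ltac:(lra)).
  assert (B5 := one 1 (3 * (m + 1)) ltac:(lra) ltac:(lra)).
  assert (B6 := one (1/3) (m + 3/2) ltac:(lra) ltac:(lra)).
  clear one. set (v := 20 * x^4 * _) in *.
  replace (120 * x^4 * (1 / (m + 1)^2)) with (6 * v) by (unfold v; field; lra).
  set (l1 := log_odd 0 (x / (2 * m + 5/2))) in *.
  set (l2 := log_odd 0 (x / (2 * m + 7/2))) in *.
  set (l3 := log_odd 0 (x / (3 * (2 * m + 3/2)))) in *.
  set (l4 := log_odd 0 (x / (3 * (2 * m + 5/2)))) in *.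
  set (l5 := log_odd 1 _) in *. set (l6 := log_odd (1/3) _) in *.
  match goal with |- Rabs (_ - ?t) <= _ => set (T := t) end.
  assert (ET : T =
    (2 * (x / (2 * m + 5/2)) + 2 * (1/3 - 0) * (x / (2 * m + 5/2))^3)
    + (2 * (x / (2 * m + 7/2)) + 2 * (1/3 - 0) * (x / (2 * m + 7/2))^3)
    - (2 * (x / (3 * (2 * m + 3/2))) + 2 * (1/3 - 0) * (x / (3 * (2 * m + 3/2)))^3)
    - (2 * (x / (3 * (2 * m + 5/2))) + 2 * (1/3 - 0) * (x / (3 * (2 * m + 5/2)))^3)
    + (2 * (x / (3 * (m + 1))) + 2 * (1/3 - 1) * (x / (3 * (m + 1)))^3)
    - (2 * (x / (m + 3/2)) + 2 * (1/3 - 1/3) * (x / (m + 3/2))^3)).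
  { unfold T, v. field. repeat split; lra. }
  rewrite ET.
  apply Rabs_le_between in B1. apply Rabs_le_between in B2. apply Rabs_le_between in B3.
  apply Rabs_le_between in B4. apply Rabs_le_between in B5. apply Rabs_le_between in B6.
  apply Rabs_le. split; lra.
Qed.

Definition lin_partial (N : nat) : R := sum_f_R0 lin_step N.
(** The constant is the cubic coefficient of [log_odd 0 (2 * x)]; the other
    leading term of [log_partial] has none. *)
Definition cube_partial (N : nat) : R := 16/3 + sum_f_R0 cube_step N.

Lemma log_partial_bound (x : R) (N : nat) :
  Rabs x <= 1/8 ->
  Rabs (log_partial x N - (x * lin_partial N + x^3 * cube_partial N)) <= 880 * x^4.
Proof.
  intro Hx.
  assert (Hx2 : Rabs (2 * x) <= 1/4) by (rewrite Rabs_mult, (Rabs_pos_eq 2); lra).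
  assert (X4 : 0 <= x^4) by (replace (x^4) with ((x^2)^2) by ring; apply pow2_ge_0).
  assert (B1 := log_odd_bound 0 (2 * x) ltac:(lra) Hx2).
  assert (B2 := log_odd_bound (1/3) (2 * x) ltac:(lra) Hx2).
  assert (B3 : Rabs (sum_f_R0 (log_step x) N
      - (x * lin_partial N + x^3 * sum_f_R0 cube_step N))
      <= 120 * x^4 * (2 - 1 / (INR N + 1))).
  { unfold lin_partial. induction N as [|N IH].
    - simpl sum_f_R0. apply Rle_trans with (1 := log_step_bound x 0 Hx).
      change (INR 0) with 0. apply Req_le. field.
    - rewrite !tech5. assert (H := log_step_bound x (S N) Hx).
      rewrite S_INR in *. assert (HN := pos_INR N).
      set (y := INR N) in *. clearbody y.
      match goal with |- Rabs ?t <= _ =>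
        replace t with ((sum_f_R0 (log_step x) N
          - (x * sum_f_R0 lin_step N + x^3 * sum_f_R0 cube_step N))
          + (log_step x (S N) - (x * lin_step (S N) + x^3 * cube_step (S N)))) by ring end.
      apply Rle_trans with (1 := Rabs_triang _ _).
      apply Rle_trans with (120 * x^4 * ((2 - 1 / (y + 1)) + 1 / (y + 1 + 1)^2)); [lra|].
      apply Rmult_le_compat_l; [lra|].
      assert (1 / (y + 1 + 1)^2 <= 1 / ((y + 1) * (y + 1 + 1))).
      { apply Rmult_le_compat_l; [lra|]. apply Rinv_le_contravar; nra. }
      assert (1 / ((y + 1) * (y + 1 + 1)) = 1 / (y + 1) - 1 / (y + 1 + 1)) by (field; lra).
      lra. }
  assert (HN := pos_INR N).
  assert (0 < 1 / (INR N + 1)) by (apply Rdiv_lt_0_compat; lra).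
  assert (B4 : 120 * x^4 * (2 - 1 / (INR N + 1)) <= 240 * x^4) by nra.
  apply (Rle_trans _ _ _ B3) in B4. clear B3.
  unfold log_partial, cube_partial.
  set (a := log_odd 0 _) in *. set (b := log_odd (1/3) _) in *.
  set (s := sum_f_R0 (log_step x) N) in *. set (c := sum_f_R0 cube_step N) in *.
  set (l := lin_partial N) in *. clearbody a b s c l.
  apply Rabs_le_between in B1. apply Rabs_le_between in B2. apply Rabs_le_between in B4.
  replace (20 * (2 * x)^4) with (320 * x^4) in * by ring.
  replace ((2 * x)^3) with (8 * x^3) in * by ring.
  apply Rabs_le. split; lra.
Qed.

Definition cube_sum (n : nat) : R := sum_f_R0 (fun i => 1 / INR (S i)^3) n.

(** The denominators [2 n + 5/2], [2 n + 7/2] run through [m + 1/2] for [m >= 2],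
    and [2 n + 3/2], [2 n + 5/2] for [m >= 1].  The missing initial terms amount to
    [- 2/3 * (8 + 8/27) + 2/81 * 8 = - 16/3], which cancels the constant in
    [cube_partial]. *)
Lemma cube_partial_eq (N : nat) :
  cube_partial N = 2/3 * odd_cube_sum (2 * N + 3) - 2/81 * odd_cube_sum (2 * N + 2)
                   - 4/81 * cube_sum N.
Proof.
  unfold cube_partial, odd_cube_sum, cube_sum. induction N as [|N IH].
  - simpl. unfold cube_step. simpl INR. field.
  - replace (2 * S N + 3)%nat with (S (S (2 * N + 3))) by lia.
    replace (2 * S N + 2)%nat with (S (S (2 * N + 2))) by lia.
    rewrite !tech5.
    match goal with |- 16/3 + (?a + ?b) = _ =>
      replace (16/3 + (a + b)) with ((16/3 + a) + b) by ring end.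
    rewrite IH. unfold cube_step.
    rewrite !S_INR, !plus_INR, !mult_INR. simpl INR.
    assert (HN := pos_INR N).
    set (y := INR N) in *. clearbody y.
    set (P := sum_f_R0 _ (2 * N + 3)). set (Q := sum_f_R0 _ (2 * N + 2)).
    set (W := sum_f_R0 _ N). clearbody P Q W. clear IH.
    field. repeat split; nra.
Qed.

(** The integers from 1 to [2 M + 2] split into odd ones, [2 (j + 1/2)], and even
    ones. *)
Lemma odd_cube_sum_eq (M : nat) : odd_cube_sum M = 8 * cube_sum (2 * M + 1) - cube_sum M.
Proof.
  unfold odd_cube_sum, cube_sum. induction M as [|M IH].
  - simpl. field.
  - replace (2 * S M + 1)%nat with (S (S (2 * M + 1))) by lia.
    rewrite !tech5, IH. rewrite !S_INR, !plus_INR, !mult_INR. simpl INR.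
    assert (HN := pos_INR M). set (y := INR M) in *. clearbody y.
    set (P := sum_f_R0 _ (2 * M + 1)). set (W := sum_f_R0 _ M). clearbody P W. clear IH.
    field. repeat split; lra.
Qed.

Lemma cube_sum_lim : is_lim_seq cube_sum zeta3.
Proof.
  assert (inc : forall n, cube_sum n <= cube_sum (S n)).
  { intro n. unfold cube_sum. rewrite tech5.
    assert (0 <= 1 / INR (S (S n))^3); [|lra].
    apply Rdiv_le_0_compat; [lra|]. apply pow_lt, lt_0_INR. lia. }
  assert (bnd : forall n, cube_sum n <= 12).
  { intro n. apply Rle_trans with (odd_cube_sum n); [|apply odd_cube_sum_le].
    unfold cube_sum, odd_cube_sum. apply sum_Rle. intros i _.
    rewrite S_INR. assert (Hi := pos_INR i).
    apply Rmult_le_compat_l; [lra|]. apply Rinv_le_contravar; [apply pow_lt; lra|].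
    apply pow_incr. lra. }
  destruct (ex_finite_lim_seq_incr cube_sum 12 inc bnd) as [l Hl].
  replace zeta3 with l; [exact Hl|].
  symmetry. apply is_series_unique.
  apply is_lim_seq_ext with (2 := Hl).
  intro n. symmetry. apply sum_n_Reals.
Qed.

Lemma cube_partial_lim : is_lim_seq cube_partial (40/9 * zeta3).
Proof.
  assert (sub : forall a b, is_lim_seq (fun N => cube_sum (S a * N + b)) zeta3).
  { intros a b. apply (is_lim_seq_subseq cube_sum _ (fun N => (S a * N + b)%nat)).
    - apply eventually_subseq. intro n. lia.
    - apply cube_sum_lim. }
  assert (odd : forall b, is_lim_seq (fun N => odd_cube_sum (2 * N + b)) (7 * zeta3)).
  { intro b.
    apply is_lim_seq_ext with
      (fun N => 8 * cube_sum (4 * N + (2 * b + 1)) - cube_sum (2 * N + b)).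
    - intro N. rewrite odd_cube_sum_eq. f_equal. f_equal. f_equal. lia.
    - replace (7 * zeta3) with (8 * zeta3 - zeta3) by ring.
      apply is_lim_seq_minus'; [|apply sub].
      apply (is_lim_seq_scal_l _ 8 zeta3), sub. }
  apply is_lim_seq_ext with (1 := fun N => eq_sym (cube_partial_eq N)).
  replace (40/9 * zeta3)
    with (2/3 * (7 * zeta3) - 2/81 * (7 * zeta3) - 4/81 * zeta3) by field.
  apply is_lim_seq_minus'; [apply is_lim_seq_minus'|].
  - apply (is_lim_seq_scal_l _ (2/3) (7 * zeta3)), odd.
  - apply (is_lim_seq_scal_l _ (2/81) (7 * zeta3)), odd.
  - apply (is_lim_seq_scal_l _ (4/81) zeta3), cube_sum_lim.
Qed.

(** The combination [L x - 2 * L (x / 2)] of the odd logarithm removes the linear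
    coefficients and multiplies the cubic one by 3/4.  Hence the cubic coefficients
    of the two expansions differ by [O(x)] for every small [x]. *)
Lemma odd_cube_ratio :
  2/3 * (Series (fun k => asin_coeff k * odd_cube_sum k) / Series asin_coeff)
  = 40/9 * zeta3.
Proof.
  set (lam := 2/3 * _).
  assert (key : forall x, 0 < x <= 1/8 -> Rabs (lam - 40/9 * zeta3) <= 1500 * x).
  { intros x Hx.
    assert (Hx1 : Rabs x <= 1/8) by (rewrite Rabs_pos_eq; lra).
    assert (Hx2 : Rabs (x/2) <= 1/8) by (rewrite Rabs_pos_eq; lra).
    set (L := fun y => ln (deformed_sum y) - ln (deformed_sum (- y))).
    assert (L1 := log_deformed_sum_odd x Hx1). assert (L2 := log_deformed_sum_odd (x/2) Hx2).
    fold (L x) in L1. fold (L (x/2)) in L2.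
    set (t := Series _ / _) in *.
    (* 990 = 880 * (1 + 2/16), from the bounds at x and x / 2. *)
    assert (B : Rabs (L x - 2 * L (x/2) - 3/4 * x^3 * (40/9 * zeta3)) <= 990 * x^4).
    { apply (is_lim_seq_le
        (fun N => Rabs (log_partial x N - 2 * log_partial (x/2) N - 3/4 * x^3 * cube_partial N))
        (fun _ => 990 * x^4)
        (Rabs (L x - 2 * L (x/2) - 3/4 * x^3 * (40/9 * zeta3))) (990 * x^4)).
      - intro N. assert (B1 := log_partial_bound x N Hx1).
        assert (B2 := log_partial_bound (x/2) N Hx2).
        replace ((x/2)^4) with (x^4/16) in B2 by field.
        replace ((x/2)^3) with (x^3/8) in B2 by field.
        apply Rabs_le_between in B1. apply Rabs_le_between in B2.
        apply Rabs_le. split; lra.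
      - apply (is_lim_seq_abs _ (L x - 2 * L (x/2) - 3/4 * x^3 * (40/9 * zeta3))).
        apply is_lim_seq_minus'; [apply is_lim_seq_minus'|].
        + apply log_partial_lim, Hx1.
        + apply (is_lim_seq_scal_l _ 2 (L (x/2))), log_partial_lim, Hx2.
        + apply (is_lim_seq_scal_l _ (3/4 * x^3) (40/9 * zeta3)), cube_partial_lim.
      - apply is_lim_seq_const. }
    replace ((x/2)^4) with (x^4/16) in L2 by field.
    replace ((x/2)^3) with (x^3/8) in L2 by field.
    apply Rabs_le_between in L1. apply Rabs_le_between in L2. apply Rabs_le_between in B.
    assert (X3 : 0 < x^3) by (apply pow_lt; lra).
    (* 990 + 82 * (1 + 2/16) < 3/4 * 1500. *)
    apply Rmult_le_reg_l with (3/4 * x^3); [lra|].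
    rewrite <- (Rabs_pos_eq (3/4 * x^3)) at 1 by lra.
    rewrite <- Rabs_mult.
    replace (3/4 * x^3 * (1500 * x)) with (1125 * x^4) by field.
    replace (3/4 * x^3 * (lam - 40/9 * zeta3))
      with (1/2 * x^3 * t - 3/4 * x^3 * (40/9 * zeta3)) by (unfold lam; field).
    apply Rabs_le. split; lra. }
  apply Rminus_diag_uniq.
  destruct (Req_dec (lam - 40/9 * zeta3) 0) as [E|E]; [exact E|exfalso].
  assert (P := Rabs_pos_lt _ E). set (d := Rabs _) in *.
  assert (K := key (Rmin (1/8) (d / 3000))).
  assert (0 < Rmin (1/8) (d / 3000)) by (apply Rmin_glb_lt; lra).
  assert (M1 := Rmin_l (1/8) (d / 3000)). assert (M2 := Rmin_r (1/8) (d / 3000)).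
  specialize (K ltac:(lra)). lra.
Qed.

(** * The undeformed sum *)

(** Coefficients of [asin s / s] as a power series in [s^2]. *)
Definition asin_pcoeff (k : nat) : R := asin_coeff k * 4 ^ k.
(** Coefficients of [1 / sqrt (1 - z)]. *)
Definition rsqrt_pcoeff (k : nat) : R := asin_pcoeff k * (2 * INR k + 1).

Lemma asin_pcoeff_succ (k : nat) :
  asin_pcoeff (S k)
  = asin_pcoeff k * ((INR k + 1/2)^2 / ((INR k + 1) * (INR k + 3/2))).
Proof.
  unfold asin_pcoeff. rewrite asin_coeff_succ. assert (H := pos_INR k).
  simpl pow. field. lra.
Qed.

Lemma asin_pcoeff_pos (k : nat) : 0 < asin_pcoeff k.
Proof. apply Rmult_lt_0_compat; [apply asin_coeff_pos|apply pow_lt; lra]. Qed.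

Lemma CV_radius_asin : CV_radius asin_pcoeff = 1.
Proof.
  replace (Finite 1) with (Finite (/ 1)) by (f_equal; field).
  apply CV_radius_finite_DAlembert; [|lra|].
  - intro k. assert (H := asin_pcoeff_pos k). lra.
  - apply is_lim_seq_ext with (fun k => (1 - 1/2 * / (INR k + 1)) * (1 - 1 * / (INR k + 3/2))).
    + intro k. rewrite asin_pcoeff_succ. assert (H := asin_pcoeff_pos k).
      assert (Hk := pos_INR k).
      rewrite Rabs_pos_eq.
      * field. lra.
      * apply Rdiv_le_0_compat; [|lra]. apply Rmult_le_pos; [lra|].
        apply Rdiv_le_0_compat; [apply pow2_ge_0|]. apply Rmult_lt_0_compat; lra.
    + assert (inv : forall a, 0 < a -> is_lim_seq (fun k => / (INR k + a)) 0).
      { intros a Ha. apply (is_lim_seq_inv _ p_infty); [|discriminate].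
        apply is_lim_seq_le_p_loc with INR; [|apply is_lim_seq_INR].
        exists O. intros k _. lra. }
      replace (Finite 1) with (Finite ((1 - 1/2 * 0) * (1 - 1 * 0))) by (f_equal; ring).
      apply is_lim_seq_mult'; (apply is_lim_seq_minus'; [apply is_lim_seq_const|]).
      * apply (is_lim_seq_scal_l _ (1/2) 0), inv; lra.
      * apply (is_lim_seq_scal_l _ 1 0), inv; lra.
Qed.

Lemma rsqrt_pcoeff_eq (k : nat) :
  rsqrt_pcoeff k
  = PS_plus asin_pcoeff (PS_scal 2 (PS_incr_1 (PS_derive asin_pcoeff))) k.
Proof.
  unfold rsqrt_pcoeff, PS_plus, PS_scal, PS_incr_1, PS_derive, plus, scal; simpl.
  unfold mult; simpl. destruct k as [|k]; simpl INR.
  - unfold zero; simpl. ring.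
  - ring.
Qed.

(** The differential equation [p' = p / 2 + z * p'] of [1 / sqrt (1 - z)]. *)
Lemma rsqrt_ode_coeff (k : nat) :
  PS_derive rsqrt_pcoeff k
  = PS_plus (PS_scal (1/2) rsqrt_pcoeff) (PS_incr_1 (PS_derive rsqrt_pcoeff)) k.
Proof.
  unfold PS_plus, PS_scal, PS_incr_1, PS_derive, plus, scal; simpl.
  unfold mult; simpl. unfold rsqrt_pcoeff.
  assert (Hk := pos_INR k).
  rewrite asin_pcoeff_succ. rewrite S_INR.
  destruct k as [|k].
  - unfold zero; simpl. field.
  - change (match k with 0%nat => 1 | S _ => INR k + 1 end) with (INR (S k)).
    field. lra.
Qed.

Lemma ex_pseries_lt_1 (a : nat -> R) (z : R) :
  CV_radius a = 1 -> Rabs z < 1 -> ex_pseries a z.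
Proof. intros Ha Hz. apply CV_radius_inside. rewrite Ha. exact Hz. Qed.

(** The right-hand side at [z = s^2] is the derivative of
    [s * PSeries asin_pcoeff (s^2)]. *)
Lemma PSeries_rsqrt_eq (z : R) :
  Rabs z < 1 ->
  PSeries rsqrt_pcoeff z
  = PSeries asin_pcoeff z + 2 * (z * PSeries (PS_derive asin_pcoeff) z).
Proof.
  intro Hz. rewrite (PSeries_ext _ _ z rsqrt_pcoeff_eq).
  assert (HD : CV_radius (PS_derive asin_pcoeff) = 1)
    by (rewrite CV_radius_derive; apply CV_radius_asin).
  rewrite PSeries_plus, PSeries_scal, PSeries_incr_1; [reflexivity| |].
  - apply ex_pseries_lt_1; [apply CV_radius_asin|exact Hz].
  - apply ex_pseries_scal; [apply Rmult_comm|]. apply ex_pseries_incr_1.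
    apply ex_pseries_lt_1; assumption.
Qed.

Lemma CV_radius_rsqrt : CV_radius rsqrt_pcoeff = 1.
Proof.
  replace (Finite 1) with (Finite (/ 1)) by (f_equal; field).
  apply CV_radius_finite_DAlembert; [|lra|].
  - intro k. unfold rsqrt_pcoeff. assert (H := asin_pcoeff_pos k). assert (Hk := pos_INR k). nra.
  - apply is_lim_seq_ext with (fun k => 1 - 1/2 * / (INR k + 1)).
    + intro k. unfold rsqrt_pcoeff. rewrite asin_pcoeff_succ, S_INR.
      assert (H := asin_pcoeff_pos k). assert (Hk := pos_INR k).
      rewrite Rabs_pos_eq.
      * field. repeat split; lra.
      * apply Rdiv_le_0_compat; [|apply Rmult_lt_0_compat; lra].
        apply Rmult_le_pos; [|lra]. apply Rmult_le_pos; [lra|].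
        apply Rdiv_le_0_compat; [apply pow2_ge_0|]. apply Rmult_lt_0_compat; lra.
    + replace (Finite 1) with (Finite (1 - 1/2 * 0)) by (f_equal; ring).
      apply is_lim_seq_minus'; [apply is_lim_seq_const|].
      apply (is_lim_seq_scal_l _ (1/2) 0).
      apply (is_lim_seq_inv _ p_infty); [|discriminate].
      apply is_lim_seq_le_p_loc with INR; [|apply is_lim_seq_INR].
      exists O. intros k _. lra.
Qed.

(** By the differential equation the left-hand side has derivative 0. *)
Lemma PSeries_rsqrt_closed (z : R) :
  0 < z < 1 -> PSeries rsqrt_pcoeff z * sqrt (1 - z) = 1.
Proof.
  intro Hz.
  transitivity (PSeries rsqrt_pcoeff 0 * sqrt (1 - 0)).
  2: { rewrite PSeries_0, Rminus_0_r, sqrt_1. unfold rsqrt_pcoeff, asin_pcoeff.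
       rewrite asin_coeff_0. simpl. ring. }
  symmetry.
  apply (eq_is_derive (fun t => PSeries rsqrt_pcoeff t * sqrt (1 - t))); [|lra].
  intros t Ht.
  assert (Ht1 : Rabs t < 1) by (rewrite Rabs_pos_eq; lra).
  assert (D := is_derive_PSeries rsqrt_pcoeff t ltac:(rewrite CV_radius_rsqrt; exact Ht1)).
  assert (HD : CV_radius (PS_derive rsqrt_pcoeff) = 1)
    by (rewrite CV_radius_derive; apply CV_radius_rsqrt).
  assert (ode : PSeries (PS_derive rsqrt_pcoeff) t
    = 1/2 * PSeries rsqrt_pcoeff t + t * PSeries (PS_derive rsqrt_pcoeff) t).
  { rewrite (PSeries_ext _ _ t rsqrt_ode_coeff) at 1.
    rewrite PSeries_plus, PSeries_scal, PSeries_incr_1; [reflexivity| |].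
    - apply ex_pseries_scal; [apply Rmult_comm|].
      apply ex_pseries_lt_1; [apply CV_radius_rsqrt|exact Ht1].
    - apply ex_pseries_incr_1, ex_pseries_lt_1; assumption. }
  assert (S1 : 0 < sqrt (1 - t)) by (apply sqrt_lt_R0; lra).
  assert (S2 : sqrt (1 - t) * sqrt (1 - t) = 1 - t) by (apply sqrt_sqrt; lra).
  assert (Dq : is_derive (fun t => sqrt (1 - t)) t (- 1 / (2 * sqrt (1 - t)))).
  { auto_derive; [lra|]. replace (1 + - t) with (1 - t) by ring. field. lra. }
  assert (E := is_derive_mult _ _ t _ _ D Dq Rmult_comm).
  cbv beta in E. unfold plus, mult in E; simpl in E.
  match type of E with is_derive _ _ ?v => assert (V : v = 0) end.
  2: { rewrite V in E. exact E. }
  clear E.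
  set (p := PSeries rsqrt_pcoeff t) in *.
  set (p' := PSeries (PS_derive rsqrt_pcoeff) t) in *. set (q := sqrt (1 - t)) in *.
  clearbody p p' q.
  assert (p = 2 * (1 - t) * p') by lra.
  apply Rmult_eq_reg_r with (2 * q); [|lra].
  replace ((p' * q + p * (-1 / (2 * q))) * (2 * q)) with (2 * p' * (q * q) - p) by (field; lra).
  rewrite S2. lra.
Qed.

(** The series [s * PSeries asin_pcoeff (s^2)] and [asin] have the same derivative
    and agree at 0; take [s = 1/2]. *)
Lemma asin_coeff_sum : Series asin_coeff = PI / 3.
Proof.
  assert (G : (fun s => s * PSeries asin_pcoeff (s^2) - asin s) 0
            = (fun s => s * PSeries asin_pcoeff (s^2) - asin s) (1/2)).
  { apply (eq_is_derive (fun s => s * PSeries asin_pcoeff (s^2) - asin s)); [|lra].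
    intros s Hs.
    assert (Hz : Rabs (s^2) < 1) by (rewrite Rabs_pos_eq; nra).
    assert (D := is_derive_PSeries asin_pcoeff (s^2)
      ltac:(rewrite CV_radius_asin; exact Hz)).
    assert (Da : is_derive asin s (1 / sqrt (1 - s^2))).
    { apply is_derive_Reals.
      apply (derive_pt_eq_1 asin s _ (derivable_pt_asin s ltac:(lra))).
      rewrite derive_pt_asin. unfold Rsqr. do 3 f_equal. ring. }
    assert (Dm : is_derive (fun s => s * PSeries asin_pcoeff (s^2)) s
      (PSeries rsqrt_pcoeff (s^2))).
    { rewrite PSeries_rsqrt_eq by exact Hz.
      set (d := PSeries (PS_derive asin_pcoeff) (s^2)) in *.
      assert (Dc : is_derive (fun s => PSeries asin_pcoeff (s^2)) s (2 * s * d)).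
      { assert (Dq : is_derive (fun s => s^2) s (2 * s)) by (auto_derive; [trivial|ring]).
        exact (is_derive_comp (PSeries asin_pcoeff) (fun s => s^2) s _ _ D Dq). }
      assert (E := is_derive_mult (fun s => s) _ s _ _ (is_derive_id s) Dc Rmult_comm).
      replace (PSeries asin_pcoeff (s^2) + 2 * (s^2 * d))
        with (plus (mult one (PSeries asin_pcoeff (s^2))) (mult s (2 * s * d)));
        [exact E|]. unfold plus, mult, one; simpl. ring. }
    assert (E := is_derive_minus _ _ s _ _ Dm Da).
    match type of E with is_derive _ _ ?v => assert (V : v = 0) end.
    2: { rewrite V in E. exact E. }
    unfold minus, plus, opp; simpl.
    destruct (Req_dec s 0) as [->|Hs0].
    - replace (0 * (0 * 1)) with 0 by ring. rewrite PSeries_0, Rminus_0_r, sqrt_1.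
      unfold rsqrt_pcoeff, asin_pcoeff. rewrite asin_coeff_0. simpl. field.
    - assert (C := PSeries_rsqrt_closed (s^2) ltac:(nra)). simpl in C.
      assert (0 < sqrt (1 - s * (s * 1))) by (apply sqrt_lt_R0; nra).
      apply Rmult_eq_reg_r with (sqrt (1 - s * (s * 1))); [|lra].
      rewrite Rmult_0_l, Rmult_plus_distr_r, C. field. lra. }
  cbv beta in G. rewrite asin_0 in G.
  assert (A : asin (1/2) = PI / 6).
  { rewrite <- sin_PI6. apply asin_sin. assert (H := PI_RGT_0). lra. }
  rewrite A in G.
  replace (Series asin_coeff) with (PSeries asin_pcoeff ((1/2)^2)); [lra|].
  unfold PSeries. apply Series_ext. intro k. unfold asin_pcoeff.
  rewrite Rmult_assoc, <- Rpow_mult_distr.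
  replace (4 * (1/2)^2) with 1 by field. rewrite pow1. ring.
Qed.

Theorem mainTheorem15 :
  is_series
    (fun k : nat =>
       Binomial.C (2 * k) k / (INR (2 * k + 1) * 16 ^ k)
       * sum_f_R0 (fun j : nat => 1 / INR (2 * j + 1) ^ 3) k)
    (5 / 18 * PI * zeta3).
Proof.
  assert (Hr := odd_cube_ratio). rewrite asin_coeff_sum in Hr.
  assert (C := Series_correct _ ex_series_asin_cube).
  set (T := Series _) in *.
  assert (E : 5/18 * PI * zeta3 = 1/8 * T).
  { assert (HP := PI_RGT_0).
    replace T with (PI / 2 * (2/3 * (T / (PI / 3)))) by (field; lra).
    rewrite Hr. field. }
  rewrite E.
  apply is_series_ext with (fun k => 1/8 * (asin_coeff k * odd_cube_sum k)).
  - intro k. unfold asin_coeff.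
    replace (sum_f_R0 (fun j => 1 / INR (2 * j + 1)^3) k) with (1/8 * odd_cube_sum k).
    + match goal with |- ?a = ?b => change (@eq R a b) end.
      field. split.
      * apply pow_nonzero. lra.
      * apply not_0_INR. lia.
    + unfold odd_cube_sum. rewrite scal_sum. apply sum_eq. intros j _.
      rewrite INR_double_succ. assert (Hj := pos_INR j).
      field; repeat split; lra.
  - exact (is_series_scal (1/8) _ _ C).
Qed.
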